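(* Let $\lambda>1$. Let $u,v\in\mathcal X$ and $q_u,q_v\in\Lambda$ be such that $(u,q_u)$ is a subsolution and $(v,q_v)$ is a supersolution (for the parameter $\lambda$), with $0=u\le v$ on $\{-1,1\}\times(-\infty,0)$ in the sense of traces. Then $u\le v$ in $\Omega$.
   Context: Points of $\mathbb R^2$ are written $(y,z)$; $\Omega=(-1,1)\times(-\infty,0)$. $\mathcal X=\{u\in W^{1,2}(\Omega): u(\pm1,\cdot)=0,\ z\nabla u\in L^1(\Omega,\mathbb R^2)\}$ and $\Lambda=\{q\in L^2_{\mathrm{loc}}(\Omega,\mathbb R^2):|q|\le1\text{ a.e.}\}$. Given $u\in\mathcal X$ non-negative and $q\in\Lambda$, the pair $(u,q)$ is called a subsolution (resp. supersolution) if $$\int_\Omega\nabla u\cdot\nabla\varphi+|z|\,q\cdot\nabla\varphi\le\lambda\int_\Omega\varphi\quad\Big(\text{resp. }\ge\lambda\int_\Omega\varphi\Big)\quad\text{for all }\varphi\in\mathcal X,\ \varphi\ge0,$$ and $q\cdot\nabla u=|\nabla u|$ a.e. in $\Omega$. *)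

(* Defs.v *)
From HB Require Import structures.
From mathcomp Require Import all_boot all_order all_algebra.
From mathcomp Require Import all_classical all_reals all_analysis.
Import Order.TTheory GRing.Theory Num.Theory numFieldNormedType.Exports.

Set Implicit Arguments.
Unset Strict Implicit.
Unset Printing Implicit Defensive.

Local Open Scope classical_set_scope.
Local Open Scope ring_scope.

(* A point (y, z) of the plane is p : R * R with y = p.1 and z = p.2.  The
   library norm on R * R is the max norm, hence the Euclidean [enorm]. *)
Definition dot (R : realType) (a b : R * R) : R := a.1 * b.1 + a.2 * b.2.

Definition enorm (R : realType) (a : R * R) : R := Num.sqrt (dot a a).

Notation leb1 R := (@lebesgue_measure R) (only parsing).
Notation leb2 R := ((@lebesgue_measure R \x @lebesgue_measure R)%E)
  (only parsing).

Definition neg_line (R : realType) : set R := `]-oo, 0[.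

Definition Omega (R : realType) : set (R * R) := `]-1, 1[ `*` @neg_line R.

Definition ae_in (R : realType) (D : set (R * R)) (P : R * R -> Prop) : Prop :=
  {ae leb2 R, forall p, D p -> P p}.

(* "for a.e. point of {-1, 1} x (-oo, 0)", for the one-dimensional measure *)
Definition ae_lateral (R : realType) (P : R * R -> Prop) : Prop :=
  forall s : R, s = -1 \/ s = 1 ->
    {ae leb1 R, forall z, neg_line z -> P (s, z)}.

Definition L1 d (T : measurableType d) (R : realType)
    (mu : {measure set T -> \bar R}) (D : set T) (f : T -> R) : Prop :=
  mu.-integrable D (EFin \o f).

Definition L2 d (T : measurableType d) (R : realType)
    (mu : {measure set T -> \bar R}) (D : set T) (f : T -> R) : Prop :=
  measurable_fun D f /\ mu.-integrable D (fun x => (f x ^+ 2)%:E).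

Definition cvg_L2 d (T : measurableType d) (R : realType)
    (mu : {measure set T -> \bar R}) (D : set T)
    (f : nat -> T -> R) (g : T -> R) : Prop :=
  (fun n => (\int[mu]_(x in D) ((f n x - g x) ^+ 2)%:E)%E : \bar R)
    @ \oo --> (0%E : \bar R).

Section classical_functions.
Variable R : realType.
Implicit Types (f : R * R -> R) (D : set (R * R)).

Definition dy f (p : R * R) : R := 'D_((1, 0) : R * R) f p.
Definition dz f (p : R * R) : R := 'D_((0, 1) : R * R) f p.

Fixpoint Ck (k : nat) f : Prop :=
  continuous f /\
  if k is k'.+1 then
    [/\ forall p, derivable f p (1, 0), forall p, derivable f p (0, 1),
        Ck k' (dy f) & Ck k' (dz f)]
  else True.

Definition tsupport f : set (R * R) := closure [set p | f p != 0].

Definition C1c f : Prop := Ck 1 f /\ compact (tsupport f).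

Definition test_function D f : Prop :=
  [/\ forall k, Ck k f, compact (tsupport f) & tsupport f `<=` D].

Definition weak_gradient D f (g : R * R -> R * R) : Prop :=
  forall phi, test_function D phi ->
    (\int[leb2 R]_(p in D) (f p * dy phi p)) =
      - (\int[leb2 R]_(p in D) ((g p).1 * phi p)) /\
    (\int[leb2 R]_(p in D) (f p * dz phi p)) =
      - (\int[leb2 R]_(p in D) ((g p).2 * phi p)).

End classical_functions.

(* W^{1,2}(Omega).  An element is a representative of the function together
   with a representative of its weak gradient; both are only meant up to
   null sets. *)
Record W12 (R : realType) := MkW12 {
  fct :> R * R -> R ;
  grad : R * R -> R * R ;
  fct_L2 : L2 (leb2 R) (@Omega R) fct ;
  grad_L2y : L2 (leb2 R) (@Omega R) (fun p => (grad p).1) ;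
  grad_L2z : L2 (leb2 R) (@Omega R) (fun p => (grad p).2) ;
  grad_weak : weak_gradient (@Omega R) fct grad }.

Section spaces.
Variable R : realType.
Local Notation Omega := (@Omega R).

(* The trace on {-1, 1} x (-oo, 0) is the extension by continuity
   W^{1,2}(Omega) -> L^2({-1, 1} x (-oo, 0)) of the restriction map, from the
   dense class of (restrictions to Omega of) C^1 functions of the plane with
   compact support.  Only the values of g on {-1, 1} x (-oo, 0) matter. *)
Definition is_trace (u : W12 R) (g : R * R -> R) : Prop :=
  (forall s : R, s = -1 \/ s = 1 ->
     L2 (leb1 R) (@neg_line R) (fun z => g (s, z))) /\
  exists w : nat -> R * R -> R,
    [/\ forall n, C1c (w n),
        cvg_L2 (leb2 R) Omega w u,
        cvg_L2 (leb2 R) Omega (fun n => dy (w n)) (fun p => (grad u p).1),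
        cvg_L2 (leb2 R) Omega (fun n => dz (w n)) (fun p => (grad u p).2) &
        forall s : R, s = -1 \/ s = 1 ->
          cvg_L2 (leb1 R) (@neg_line R)
            (fun n z => w n (s, z)) (fun z => g (s, z))].

Definition spaceX (u : W12 R) : Prop :=
  [/\ is_trace u (fun _ => 0),
      L1 (leb2 R) Omega (fun p => p.2 * (grad u p).1) &
      L1 (leb2 R) Omega (fun p => p.2 * (grad u p).2)].

Definition L2loc (q : R * R -> R * R) : Prop :=
  forall K : set (R * R), compact K -> K `<=` Omega ->
    L2 (leb2 R) K (fun p => (q p).1) /\ L2 (leb2 R) K (fun p => (q p).2).

Definition Lambda (q : R * R -> R * R) : Prop :=
  L2loc q /\ ae_in Omega (fun p => enorm (q p) <= 1).

Definition nonneg (u : W12 R) : Prop := ae_in Omega (fun p => 0 <= u p).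

Definition weak_form (u : W12 R) (q : R * R -> R * R) (phi : W12 R) : R :=
  \int[leb2 R]_(p in Omega)
    (dot (grad u p) (grad phi p) + `|p.2| * dot (q p) (grad phi p)).

Definition subsolution (lambda : R) (u : W12 R) (q : R * R -> R * R) : Prop :=
  [/\ spaceX u, nonneg u, Lambda q,
      forall phi : W12 R, spaceX phi -> nonneg phi ->
        weak_form u q phi <= lambda * (\int[leb2 R]_(p in Omega) phi p) &
      ae_in Omega (fun p => dot (q p) (grad u p) = enorm (grad u p))].

Definition supersolution (lambda : R) (u : W12 R) (q : R * R -> R * R) : Prop :=
  [/\ spaceX u, nonneg u, Lambda q,
      forall phi : W12 R, spaceX phi -> nonneg phi ->
        weak_form u q phi >= lambda * (\int[leb2 R]_(p in Omega) phi p) &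
      ae_in Omega (fun p => dot (q p) (grad u p) = enorm (grad u p))].

End spaces.

(* Main.v *)
(* Let w = u - v, and test both inequalities with phi = G(w), where G is a convex
   C^1 function vanishing exactly on (-oo, 0], with 0 <= G' <= 1 and G'
   Lipschitz.  Subtracting them, the integral over Omega of
     G'(w) |grad w|^2 + |z| G'(w) (q_u - q_v) . (grad u - grad v)
   is at most 0.  Both terms are nonnegative, the second because
   q_u . grad u = |grad u|, q_v . grad v = |grad v| and |q_u|, |q_v| <= 1.  So
   grad phi = 0, and phi = 0 by the Poincare inequality, since phi has zero
   trace.  That phi is an admissible test function follows by composing with G
   the C^1 functions that approximate w: as G is C^1, unlike the positive part,
   G'(w_n) converges to G'(w) without any analysis of the set {w = 0}. *)

Require Import Defs.
From mathcomp Require Import all_boot all_order all_algebra.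
From mathcomp Require Import all_classical all_reals all_analysis.
From mathcomp Require Import measurable_realfun ring lra.
Import Order.TTheory GRing.Theory Num.Theory numFieldNormedType.Exports.
Set Implicit Arguments.
Unset Strict Implicit.
Unset Printing Implicit Defensive.
Local Open Scope classical_set_scope.
Local Open Scope ring_scope.

(** * A convex C^1 function with derivative in [0, 1], vanishing exactly on the nonpositive
    half-line *)

Section smoothed_positive_part.
Variable R : realType.
Implicit Types s t : R.

(** Every property of phi is obtained by passing to the limit along one sequence: the differences of
    the [C1c] functions that [is_trace] supplies for u and v, composed with G. These functions need
    not vanish on the lateral sides; only their boundary values tend to 0 in L^2. The Poincare
    inequality is therefore proved for C^1 functions with boundary terms, which disappear in the
    limit. Since Omega is bounded in y, that inequality involves the y-derivative alone. It is thus
    enough to make the integral of (G'(w) w_y)^2 vanish, and this is at most that of G'(w) w_y^2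
    because 0 <= G' <= 1. The same bound makes z grad phi inherit integrability from z grad u and z
    grad v, although the weight |z| is unbounded. The obstacle is the convergence of G'(w_n) grad
    w_n in L^2, where grad w is only square integrable: the Lipschitz bound on G' helps where grad w
    is bounded, and the bound G' <= 1 takes care of the rest. *)

Definition clamp01 t : R := Num.min (Num.max t 0) 1.

(* The Legendre transform of c |-> c^2/2 on [0, 1]: a convex C^1 substitute for
   the positive part, with derivative [clamp01]. *)
Definition spos t : R := clamp01 t * t - clamp01 t ^+ 2 / 2.

Lemma clamp01P t : [\/ t <= 0 /\ clamp01 t = 0, 0 <= t <= 1 /\ clamp01 t = t |
  1 <= t /\ clamp01 t = 1].
Proof.
rewrite /clamp01; have [t0|t0] := leP t 0.
  by apply: Or31; split => //; rewrite min_l.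
have [t1|t1] := leP t 1; first by apply: Or32; split => //; lra.
by apply: Or33; split => //; lra.
Qed.

Lemma clamp01_ge0 t : 0 <= clamp01 t.
Proof. by case: (clamp01P t) => -[? ->] //; lra. Qed.

Lemma clamp01_le1 t : clamp01 t <= 1.
Proof. by case: (clamp01P t) => -[? ->] //; lra. Qed.

Lemma clamp01_lip s t : `|clamp01 s - clamp01 t| <= `|s - t|.
Proof.
rewrite (ler_norml (clamp01 s - _)).
have := ler_norm (s - t); have := ler_norm (- (s - t)); rewrite normrN.
by case: (clamp01P s) => -[? ->]; case: (clamp01P t) => -[? ->]; lra.
Qed.

Lemma continuous_clamp01 : continuous clamp01.
Proof.
move=> t; apply: (@continuous_min R R (fun t => Num.max t 0) (fun=> 1) t).
  by apply: (@continuous_max R R id (fun=> 0) t); [exact: cvg_id|exact: cvg_cst].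
exact: cvg_cst.
Qed.

Lemma spos_ge0 t : 0 <= spos t.
Proof. by rewrite /spos; case: (clamp01P t) => -[? ->]; nra. Qed.

Lemma spos0 : spos 0 = 0.
Proof. by rewrite /spos; case: (clamp01P 0) => -[? ->]; lra. Qed.

Lemma spos_eq0 t : spos t = 0 -> t <= 0.
Proof. by rewrite /spos; case: (clamp01P t) => -[? ->]; nra. Qed.

Lemma spos_lip s t : `|spos s - spos t| <= `|s - t|.
Proof.
rewrite /spos.
have := ler_norm (s - t); have := ler_norm (- (s - t)); rewrite normrN => h1 h2.
rewrite ler_norml; move: h1 h2; set m := `|s - t|.
by case: (clamp01P s) => -[? ->]; case: (clamp01P t) => -[? ->]; nra.
Qed.

(** Fenchel-Young inequality: [spos t] is the supremum over [c] in [0, 1] of the affine functions on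
    the left, attained at [c = clamp01 t]. *)
Lemma spos_ge c t : 0 <= c <= 1 -> c * t - c ^+ 2 / 2 <= spos t.
Proof.
move=> /andP[c0 c1]; rewrite /spos.
case: (clamp01P t) => -[t01 ->]; [nra| |].
  by have := sqr_ge0 (t - c); nra.
have : 0 <= (1 - c) * (t - 1) by apply: mulr_ge0; lra.
by have := sqr_ge0 (1 - c); nra.
Qed.

(** By [spos_ge], the increment of [spos] from [t] to [s] lies between [clamp01 t * (s - t)] and
    [clamp01 s * (s - t)]; these differ by at most [(s - t) ^+ 2] as [clamp01] is 1-Lipschitz. The
    bound is uniform, so the derivative needs no case distinction at the kinks of [clamp01]. *)
Lemma spos_taylor s t :
  `|spos s - spos t - clamp01 t * (s - t)| <= (s - t) ^+ 2.
Proof.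
have h1 : (clamp01 s - clamp01 t) * (s - t) <= (s - t) ^+ 2.
  rewrite (le_trans (ler_norm _))// normrM -(real_normK (num_real (s - t))) expr2.
  by rewrite ler_wpM2r// clamp01_lip.
have c01 r : 0 <= clamp01 r <= 1 by rewrite clamp01_ge0 clamp01_le1.
have h2 := spos_ge s (c01 t); have h3 := spos_ge t (c01 s).
move: h1 h2 h3; rewrite /spos ler_norml => *; apply/andP; split; last nra.
by have := sqr_ge0 (s - t); nra.
Qed.

Lemma is_derive_spos t : is_derive t 1 spos (clamp01 t).
Proof.
have h : h^-1 *: (spos (h *: 1 + t) - spos t) @[h --> 0^'] --> clamp01 t.
  apply/cvgrPdist_le => e e0; near=> h.
  have h0 : h != 0 by near: h; exact: nbhs_dnbhs_neq.
  rewrite /= [h *: 1]mulr1 distrC.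
  have := spos_taylor (h + t) t; rewrite addrK => ht.
  have -> : h^-1 *: (spos (h + t) - spos t) - clamp01 t =
      h^-1 * (spos (h + t) - spos t - clamp01 t * h).
    by rewrite mulrBr mulrCA mulVf// mulr1.
  rewrite normrM normfV ler_pdivrMl ?normr_gt0//.
  apply: (le_trans ht); rewrite -(real_normK (num_real h)) expr2 ler_wpM2l//.
  by near: h; exact: dnbhs0_le.
by apply: DeriveDef; [apply/cvg_ex; exists (clamp01 t)|exact: cvg_lim].
Unshelve. all: by end_near. Qed.

End smoothed_positive_part.

(** * The chain rule along a line *)

Section C1_calculus.
Variable R : realType.
Implicit Types (f g : R * R -> R) (p v : R * R).

Lemma derive_line f p v : 'D_v f p = derive1 (fun h : R => f (h *: v + p)) 0.
Proof.
rewrite derive1E /derive.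
set F := (X in lim (X @ _)); set G := (X in _ = lim (X @ _)).
suff -> : F = G by [].
by apply/funext => h; rewrite /F /G /= addr0 scale0r add0r [_%:A]mulr1.
Qed.

(** Only the derivative of [f] in the direction [v] is assumed, so the chain rule is the
    one-variable one, applied to the restriction of [f] to the line through [p]. *)
Lemma is_derive_spos_comp f p v : derivable f p v ->
  is_derive p v (@spos R \o f) (clamp01 (f p) * 'D_v f p).
Proof.
move=> /derivable1P df.
have ds t : derivable (@spos R) t 1 by case: (is_derive_spos t).
apply: DeriveDef.
  apply/derivable1P; apply/derivable1_diffP.
  apply: (@differentiable_comp _ _ _ _ (fun h : R => f (h *: v + p)) (@spos R)).
    exact/derivable1_diffP.
  exact/derivable1_diffP.
rewrite derive_line (@derive1_comp R (fun h : R => f (h *: v + p)) (@spos R))//.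
rewrite scale0r add0r -derive_line [X in X * _]derive1E.
by have [_ ->] := is_derive_spos (f p).
Qed.

End C1_calculus.

(** * Algebra of C^1 functions, with and without compact support *)

Section C1c.
Variable R : realType.
Implicit Types (f g : R * R -> R) (p v : R * R).

Lemma Ck1P f : Ck 1 f <-> [/\ continuous f, forall p, derivable f p (1, 0),
  forall p, derivable f p (0, 1), continuous (dy f) & continuous (dz f)].
Proof.
split=> [[cf [fy fz [cfy _] [cfz _]]]|[cf fy fz cfy cfz]].
  exact: And5 cf fy fz cfy cfz.
exact: (conj cf (And4 fy fz (conj cfy I) (conj cfz I))).
Qed.

Lemma dyB f g p : derivable f p (1, 0) -> derivable g p (1, 0) ->
  dy (f \- g) p = dy f p - dy g p.
Proof. exact: deriveB. Qed.

Lemma dzB f g p : derivable f p (0, 1) -> derivable g p (0, 1) ->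
  dz (f \- g) p = dz f p - dz g p.
Proof. exact: deriveB. Qed.

Lemma Ck1B f g : Ck 1 f -> Ck 1 g -> Ck 1 (f \- g).
Proof.
move=> /Ck1P[cf fy fz cfy cfz] /Ck1P[cg gy gz cgy cgz].
have -> : f \- g = f - g by [].
apply/Ck1P; split.
- by move=> p; apply: cvgB; [exact: cf|exact: cg].
- by move=> p; apply: derivableB.
- by move=> p; apply: derivableB.
- have -> : dy (f - g) = dy f - dy g by apply/funext => p; exact: dyB.
  by move=> p; apply: cvgB; [exact: cfy|exact: cgy].
- have -> : dz (f - g) = dz f - dz g by apply/funext => p; exact: dzB.
  by move=> p; apply: cvgB; [exact: cfz|exact: cgz].
Qed.

Lemma dyM f g p : derivable f p (1, 0) -> derivable g p (1, 0) ->
  dy (f \* g) p = f p * dy g p + dy f p * g p.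
Proof.
move=> fy gy; have := deriveM fy gy; rewrite /dy => ->; congr (_ + _); exact: mulrC.
Qed.

Lemma dzM f g p : derivable f p (0, 1) -> derivable g p (0, 1) ->
  dz (f \* g) p = f p * dz g p + dz f p * g p.
Proof.
move=> fy gy; have := deriveM fy gy; rewrite /dz => ->; congr (_ + _); exact: mulrC.
Qed.

Lemma Ck1M f g : Ck 1 f -> Ck 1 g -> Ck 1 (f \* g).
Proof.
move=> /Ck1P[cf fy fz cfy cfz] /Ck1P[cg gy gz cgy cgz].
apply/Ck1P; split.
- by move=> p; apply: cvgM; [exact: cf|exact: cg].
- by move=> p; apply: derivableM.
- by move=> p; apply: derivableM.
- have -> : dy (f \* g) = fun p => f p * dy g p + dy f p * g p.
    by apply/funext => p; exact: dyM.
  move=> p; apply: cvgD; apply: cvgM;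
    [exact: cf|exact: cgy|exact: cfy|exact: cg].
- have -> : dz (f \* g) = fun p => f p * dz g p + dz f p * g p.
    by apply/funext => p; exact: dzM.
  move=> p; apply: cvgD; apply: cvgM;
    [exact: cf|exact: cgz|exact: cfz|exact: cg].
Qed.

Lemma dy_spos f p : derivable f p (1, 0) ->
  dy (@spos R \o f) p = clamp01 (f p) * dy f p.
Proof. by move=> /is_derive_spos_comp[]. Qed.

Lemma dz_spos f p : derivable f p (0, 1) ->
  dz (@spos R \o f) p = clamp01 (f p) * dz f p.
Proof. by move=> /is_derive_spos_comp[]. Qed.

Lemma continuous_spos : continuous (@spos R).
Proof.
move=> t; apply: differentiable_continuous; apply/derivable1_diffP.
by case: (is_derive_spos t).
Qed.

Lemma Ck1_spos f : Ck 1 f -> Ck 1 (@spos R \o f).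
Proof.
move=> /Ck1P[cf fy fz cfy cfz].
have cc : continuous (@clamp01 R \o f).
  move=> p; apply: continuous_comp; first exact: cf.
  exact: continuous_clamp01.
apply/Ck1P; split.
- move=> p; apply: continuous_comp; [exact: cf|exact: continuous_spos].
- by move=> p; case: (is_derive_spos_comp (fy p)).
- by move=> p; case: (is_derive_spos_comp (fz p)).
- have -> : dy (@spos R \o f) = fun p => clamp01 (f p) * dy f p.
    by apply/funext => p; exact: dy_spos.
  by move=> p; apply: cvgM; [exact: cc|exact: cfy].
- have -> : dz (@spos R \o f) = fun p => clamp01 (f p) * dz f p.
    by apply/funext => p; exact: dz_spos.
  by move=> p; apply: cvgM; [exact: cc|exact: cfz].
Qed.

Lemma tsupport_out f p : ~ tsupport f p -> \forall q \near p, f q = 0.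
Proof.
move=> fp; have oC : open (~` tsupport f) by exact/closed_openC/closed_closure.
have : nbhs p (~` tsupport f) by exact: open_nbhs_nbhs.
apply: filterS => q fq; apply/eqP; apply: contrapT => /negP fq0.
by apply: fq; exact: subset_closure.
Qed.

Lemma derive_out f p v : ~ tsupport f p -> 'D_v f p = 0.
Proof.
by move=> /tsupport_out f0; rewrite (near_eq_derive (g := cst 0) _ f0) derive_cst.
Qed.

Lemma compact_tsupportS f (K : set (R * R)) : compact K ->
  (forall p, ~ K p -> f p = 0) -> compact (tsupport f).
Proof.
move=> cK fK; apply: (subclosed_compact _ cK); first exact: closed_closure.
have clK : closed K by exact: compact_closed cK.
move=> p; rewrite (proj1 (closure_id K) clK); apply: closureS => q /= fq.
by apply: contrapT => /fK f0; rewrite f0 eqxx in fq.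
Qed.

Lemma tsupport_eq0 f p : ~ tsupport f p -> f p = 0.
Proof. by move/tsupport_out; exact: nbhs_singleton. Qed.

Lemma C1cB f g : C1c f -> C1c g -> C1c (f \- g).
Proof.
move=> [Cf sf] [Cg sg]; split; first exact: Ck1B.
apply: (compact_tsupportS (compactU sf sg)) => p /not_orP[pf pg] /=.
by rewrite !tsupport_eq0// subr0.
Qed.

Lemma C1cM f g : Ck 1 f -> C1c g -> C1c (f \* g).
Proof.
move=> Cf [Cg sg]; split; first exact: Ck1M.
by apply: (compact_tsupportS sg) => p pf /=; rewrite (tsupport_eq0 pf) mulr0.
Qed.

Lemma C1c_spos f : C1c f -> C1c (@spos R \o f).
Proof.
move=> [Cf sf]; split; first exact: Ck1_spos.
by apply: (compact_tsupportS sf) => p pf /=; rewrite (tsupport_eq0 pf) spos0.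
Qed.

Lemma C1c_bounded_support f : C1c f -> exists2 M : R, 0 < M &
  forall p, M < `|p.1| \/ M < `|p.2| -> ~ tsupport f p.
Proof.
move=> [_ sf]; have /compact_bounded[M [_ hM]] := sf.
exists (`|M| + 1) => [|p pM fp]; first by rewrite ltr_wpDl.
have := hM (`|M| + 1); rewrite (le_lt_trans (ler_norm M)) ?ltrDl//.
move=> /(_ isT _ fp) /=; rewrite prod_normE ge_max => /andP[p1 p2].
by case: pM; rewrite ltNge ?p1 ?p2.
Qed.

End C1c.

(** * Convergence in L^2 *)

Section L2_theory.
Context d (T : measurableType d) (R : realType).
Variable mu : {measure set T -> \bar R}.
Variables (D : set T) (mD : measurable D).
Implicit Types f g h : T -> R.

(** The epsilon form of convergence to 0 in the extended reals; the bound by [e%:E] also forces the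
    terms to be eventually finite. *)
Lemma ge0_cvge0P (a : (\bar R)^nat) : (forall n, (0 <= a n)%E) ->
  (a @ \oo --> 0%E <-> forall e, 0 < e -> \forall n \near \oo, (a n <= e%:E)%E).
Proof.
move=> a0; split => [ca e e0|h].
  have /fine_cvgP[fa /cvgr0Pnorm_le/(_ e e0) ale] := ca.
  near=> n; rewrite -[a n]fineK; last by near: n.
  by rewrite lee_fin (le_trans (ler_norm _))//; near: n.
apply/fine_cvgP; split.
  near=> n; rewrite ge0_fin_numE//; apply: (@le_lt_trans _ _ 1%:E) (ltry _).
  by near: n; exact: h.
apply/cvgr0Pnorm_le => e e0; near=> n.
have an : (a n <= e%:E)%E by near: n; exact: h.
have fn : a n \is a fin_num by rewrite ge0_fin_numE// (le_lt_trans an) ?ltry.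
by rewrite ger0_norm ?fine_ge0// -lee_fin fineK.
Unshelve. all: by end_near. Qed.

Lemma cvge0_le (a b : (\bar R)^nat) : (forall n, (0 <= a n <= b n)%E) ->
  b @ \oo --> 0%E -> a @ \oo --> 0%E.
Proof.
move=> ab b0; apply: (squeeze_cvge (f := cst 0%E) _ _ b0); last exact: cvg_cst.
exact: nearW.
Qed.

Lemma cvge0_lin (a b : (\bar R)^nat) (k l : R) :
  a @ \oo --> 0%E -> b @ \oo --> 0%E ->
  (fun n => k%:E * a n + l%:E * b n)%E @ \oo --> 0%E.
Proof.
move=> a0 b0; have -> : 0%E = (k%:E * 0 + l%:E * 0)%E :> \bar R.
  by rewrite !mule0 adde0.
by apply: cvgeD; [rewrite !mule0|exact: cvgeZl|exact: cvgeZl].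
Qed.

(** The squared L^2 norm, with value [+oo] allowed, so that estimates between norms require
    measurability only. *)
Definition sqint f : \bar R := (\int[mu]_(x in D) (f x ^+ 2)%:E)%E.

Lemma sqint_ge0 f : (0 <= sqint f)%E.
Proof. by apply: integral_ge0 => x _; rewrite lee_fin sqr_ge0. Qed.

Lemma measurable_sqr f : measurable_fun D f ->
  measurable_fun D (fun x => (f x ^+ 2)%:E : \bar R).
Proof. by move=> mf; apply/measurable_EFinP; exact: measurable_funX. Qed.

Lemma sqint_le f g : measurable_fun D f -> measurable_fun D g ->
  (forall x, D x -> `|f x| <= `|g x|) -> (sqint f <= sqint g)%E.
Proof.
move=> mf mg fg; apply: ge0_le_integral => //.
- by move=> x _; rewrite lee_fin sqr_ge0.
- exact: measurable_sqr.
- exact: measurable_sqr.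
- move=> x Dx; rewrite lee_fin -(real_normK (num_real (f x))).
  by rewrite -(real_normK (num_real (g x))) lerXn2r ?nnegrE ?fg.
Qed.

Lemma integral_lin (k l : R) (f g : T -> R) : 0 <= k -> 0 <= l ->
  (forall x, D x -> 0 <= f x) -> (forall x, D x -> 0 <= g x) ->
  measurable_fun D f -> measurable_fun D g ->
  (\int[mu]_(x in D) (k * f x + l * g x)%R%:E =
   k%:E * \int[mu]_(x in D) (f x)%:E + l%:E * \int[mu]_(x in D) (g x)%:E)%E.
Proof.
move=> k0 l0 f0 g0 mf mg.
have mZ (m : R) h : measurable_fun D h ->
    measurable_fun D (fun x => (m * h x)%:E : \bar R).
  by move=> mh; apply/measurable_EFinP; exact: measurable_funM.
under eq_integral do rewrite EFinD.
rewrite ge0_integralD//; first 1 last.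
- by move=> x Dx; rewrite lee_fin mulr_ge0// f0.
- exact: mZ.
- by move=> x Dx; rewrite lee_fin mulr_ge0// g0.
- exact: mZ.
under eq_integral do rewrite EFinM.
under [X in (_ + X)%E]eq_integral do rewrite EFinM.
by rewrite !ge0_integralZl//; try exact/measurable_EFinP;
  move=> x Dx; rewrite lee_fin ?f0 ?g0.
Qed.

Lemma le_integral_lin (k l : R) (f g h : T -> R) : 0 <= k -> 0 <= l ->
  (forall x, D x -> 0 <= f x) -> (forall x, D x -> 0 <= g x) ->
  (forall x, D x -> 0 <= h x) ->
  measurable_fun D f -> measurable_fun D g -> measurable_fun D h ->
  (forall x, D x -> f x <= k * g x + l * h x) ->
  (\int[mu]_(x in D) (f x)%:E <=
   k%:E * \int[mu]_(x in D) (g x)%:E + l%:E * \int[mu]_(x in D) (h x)%:E)%E.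
Proof.
move=> k0 l0 f0 g0 h0 mf mg mh fgh; rewrite -integral_lin//.
apply: ge0_le_integral => //.
- exact/measurable_EFinP.
- by apply/measurable_EFinP/measurable_funD; exact: measurable_funM.
Qed.

(** Stands in for the triangle inequality: estimates of L^2 norms reduce to pointwise quadratic
    ones, usually with [k = l = 2] from (a + b)^2 <= 2 a^2 + 2 b^2. *)
Lemma sqint_lin (k l : R) f g h : 0 <= k -> 0 <= l ->
  measurable_fun D f -> measurable_fun D g -> measurable_fun D h ->
  (forall x, D x -> f x ^+ 2 <= k * g x ^+ 2 + l * h x ^+ 2) ->
  (sqint f <= k%:E * sqint g + l%:E * sqint h)%E.
Proof.
move=> k0 l0 mf mg mh fgh; apply: le_integral_lin => //;
  by [move=> *; exact: sqr_ge0|exact: measurable_funX].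
Qed.

Lemma sqintD f g h : measurable_fun D f -> measurable_fun D g ->
  measurable_fun D h -> (forall x, D x -> f x = g x + h x) ->
  (sqint f <= 2%:E * sqint g + 2%:E * sqint h)%E.
Proof.
move=> mf mg mh fgh; apply: sqint_lin => // x Dx; rewrite fgh//.
by have := sqr_ge0 (g x - h x); nra.
Qed.

Lemma L2P f : L2 mu D f <-> measurable_fun D f /\ (sqint f < +oo)%E.
Proof.
split=> [[mf /integrableP[_]]|[mf foo]].
  by under eq_integral do rewrite gee0_abs ?lee_fin ?sqr_ge0//.
split=> //; apply/integrableP; split; first exact: measurable_sqr.
by under eq_integral do rewrite gee0_abs ?lee_fin ?sqr_ge0//.
Qed.

Lemma L2_le f g : measurable_fun D f -> L2 mu D g ->
  (forall x, D x -> `|f x| <= `|g x|) -> L2 mu D f.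
Proof.
move=> mf /L2P[mg goo] fg; apply/L2P; split=> //.
exact: le_lt_trans (sqint_le mf mg fg) goo.
Qed.

Lemma L2B f g : L2 mu D f -> L2 mu D g -> L2 mu D (fun x => f x - g x).
Proof.
move=> /L2P[mf foo] /L2P[mg goo]; apply/L2P; split; first exact: measurable_funB.
apply: le_lt_trans (sqint_lin (k := 2) (l := 2) _ _ _ mf mg _) _ => //.
- exact: measurable_funB.
- by move=> x Dx; have := sqr_ge0 (f x + g x); nra.
- by rewrite lte_add_pinfty// lte_mul_pinfty.
Qed.

Lemma L2_integrableM f g : L2 mu D f -> L2 mu D g -> L1 mu D (fun x => f x * g x).
Proof.
move=> [mf fi] [mg gi]; apply: le_integrable (integrableD _ fi gi) => //.
- by apply/measurable_EFinP; exact: measurable_funM.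
- move=> x Dx; rewrite /= lee_fin [leRHS]ger0_norm; last first.
    by rewrite addr_ge0// sqr_ge0.
  rewrite ler_norml; have := sqr_ge0 (f x + g x); have := sqr_ge0 (f x - g x).
  by have := sqr_ge0 (f x); have := sqr_ge0 (g x); move=> *; apply/andP; split; nra.
Qed.

Lemma cvg_L2E (f_ : nat -> T -> R) f :
  cvg_L2 mu D f_ f = (sqint (fun x => f_ n x - f x) @[n --> \oo] --> 0%E).
Proof. by []. Qed.

Lemma cvg_L2B (f_ g_ : nat -> T -> R) f g :
  (forall n, measurable_fun D (f_ n)) -> (forall n, measurable_fun D (g_ n)) ->
  measurable_fun D f -> measurable_fun D g ->
  cvg_L2 mu D f_ f -> cvg_L2 mu D g_ g ->
  cvg_L2 mu D (fun n x => f_ n x - g_ n x) (fun x => f x - g x).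
Proof.
rewrite !cvg_L2E => mf_ mg_ mf mg cf cg.
apply: cvge0_le (cvge0_lin 2 2 cf cg) => n; rewrite sqint_ge0/=.
apply: sqint_lin => //.
- by apply: measurable_funB; exact: measurable_funB.
- exact: measurable_funB.
- exact: measurable_funB.
- move=> x Dx.
  by have := sqr_ge0 ((f_ n x - f x) + (g_ n x - g x)); nra.
Qed.

Lemma cvg_L2_sqint0 (f_ : nat -> T -> R) f :
  (forall n, measurable_fun D (f_ n)) -> measurable_fun D f ->
  cvg_L2 mu D f_ f -> sqint (f_ n) @[n --> \oo] --> 0%E -> sqint f = 0%E.
Proof.
rewrite cvg_L2E => mf_ mf cf f0.
have h : (fun=> sqint f) @ \oo --> 0%E.
  apply: cvge0_le (cvge0_lin 2 2 cf f0) => n; rewrite sqint_ge0/=.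
  apply: sqint_lin => //; first exact: measurable_funB.
  by move=> x Dx; have := sqr_ge0 (f_ n x + (f_ n x - f x)); nra.
by apply: cvg_unique h => //; exact: cvg_cst.
Qed.

Lemma sqint0_cvg_L2 (f_ : nat -> T -> R) f :
  (forall n, measurable_fun D (f_ n)) -> measurable_fun D f ->
  cvg_L2 mu D f_ f -> sqint f = 0%E -> sqint (f_ n) @[n --> \oo] --> 0%E.
Proof.
rewrite cvg_L2E => mf_ mf cf f0.
have h : (fun=> sqint f) @ \oo --> 0%E by rewrite f0; exact: cvg_cst.
apply: cvge0_le (cvge0_lin 2 2 cf h) => n; rewrite sqint_ge0/=.
apply: sqintD => //; first exact: measurable_funB.
by move=> x Dx; rewrite subrK.
Qed.

Lemma sqint0_ae f : measurable_fun D f -> sqint f = 0%E ->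
  {ae mu, forall x, D x -> f x = 0}.
Proof.
move=> mf f0; have := @ae_eq_integral_abs _ _ _ mu D mD _ (measurable_sqr mf).
under eq_integral do rewrite gee0_abs ?lee_fin ?sqr_ge0//.
move=> [/(_ f0) + _]; apply: filterS => x /= h Dx.
by have [/eqP] := h Dx; rewrite sqrf_eq0 => /eqP.
Qed.

(** Strong convergence implies weak convergence; this is what carries the integration by parts
    formula from the approximating functions to their limit. *)
Lemma cvg_L2_RintegralM (f_ : nat -> T -> R) f g :
  (forall n, L2 mu D (f_ n)) -> L2 mu D f -> L2 mu D g -> cvg_L2 mu D f_ f ->
  \int[mu]_(x in D) (f_ n x * g x) @[n --> \oo] --> \int[mu]_(x in D) (f x * g x).
Proof.
rewrite cvg_L2E => Lf_ Lf Lg cf.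
pose a n := (\int[mu]_(x in D) (`|(f_ n x - f x) * g x|)%:E)%E.
have La n : L1 mu D (fun x => (f_ n x - f x) * g x).
  exact: L2_integrableM (L2B (Lf_ n) Lf) Lg.
have a0 n : (0 <= a n)%E by apply: integral_ge0 => x _; rewrite lee_fin.
have ca : a @ \oo --> 0%E.
  apply/ge0_cvge0P => // e e0.
  have /L2P[mg goo] := Lg.
  have gf : sqint g \is a fin_num by rewrite ge0_fin_numE// sqint_ge0.
  set B := fine (sqint g); have B0 : 0 <= B by rewrite fine_ge0// sqint_ge0.
  (* AM-GM: |st| <= s^2/k + k t^2, with k so small that k |g|^2 <= e/2 *)
  pose k := e / (2 * (B + 1)); have k0 : 0 < k by rewrite divr_gt0// mulr_gt0//; lra.
  have kB : k * B <= e / 2.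
    rewrite /k mulrAC ler_pdivrMr; last by lra.
    nra.
  have := (ge0_cvge0P (fun n => sqint_ge0 _)).1 cf (k * (e / 2)).
  rewrite mulr_gt0//; last lra.
  move=> /(_ isT); apply: filterS => n hn.
  apply: (@le_trans _ _
      (k^-1%:E * sqint (fun x => f_ n x - f x)%R + k%:E * sqint g)%E).
    apply: le_integral_lin => //.
    - by rewrite invr_ge0 ltW.
    - exact: ltW.
    - by move=> x Dx; exact: sqr_ge0.
    - by move=> x Dx; exact: sqr_ge0.
    - apply: measurableT_comp => //; apply/measurable_EFinP.
      exact: measurable_int (La n).
    - by apply/measurable_funX/measurable_funB; [case: (Lf_ n)|case: Lf].
    - exact: measurable_funX.
    - move=> x Dx; rewrite normrM.
      rewrite -[(f_ n x - f x) ^+ 2](real_normK (num_real _)).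
      rewrite -[g x ^+ 2](real_normK (num_real _)).
      move: `|f_ n x - f x| `|g x| => s t.
      have -> : k^-1 * s ^+ 2 + k * t ^+ 2 =
          s * t + k^-1 * ((s - k * t / 2) ^+ 2 + 3 / 4 * (k * t) ^+ 2).
        by field; rewrite gt_eqF.
      rewrite lerDl; apply: mulr_ge0; first by rewrite invr_ge0 ltW.
      by have := sqr_ge0 (s - k * t / 2); have := sqr_ge0 (k * t); lra.
  have -> : e = k^-1 * (k * (e / 2)) + e / 2.
    by rewrite mulKf ?gt_eqF//; lra.
  rewrite EFinD leeD//; first by rewrite [leRHS]EFinM lee_pmul2l// lte_fin invr_gt0.
  by rewrite -(fineK gf) -EFinM lee_fin.
have fin n : a n \is a fin_num.
  by have /integrable_norm/integrable_fin_num := La n; exact.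
have ca' : fine (a n) @[n --> \oo] --> (0 : R) by move/fine_cvgP : ca => [].
apply/subr_cvg0; apply/norm_cvg0P; apply: squeeze_cvgr ca'; last exact: (cvg_cst 0).
near=> n; rewrite normr_ge0/=.
have L1m h : L2 mu D h -> L1 mu D (fun x => h x * g x) by move/L2_integrableM; exact.
rewrite -RintegralB//; [|exact: L1m|exact: L1m].
under eq_Rintegral do rewrite -mulrBl.
exact: (le_normr_Rintegral mD (La n)).
Unshelve. all: by end_near. Qed.

(** Dominated convergence: the integrand lies between 0 and [g x ^+ 2], and it is 0 as soon as [n]
    exceeds [g x ^+ 2]. It measures the part of [g] on which no uniform bound is available. *)
Lemma truncation_cvg0 g : L2 mu D g ->
  (\int[mu]_(x in D) (g x ^+ 2 - Num.min (g x ^+ 2) n%:R)%R%:E)%E @[n --> \oo]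
    --> 0%E.
Proof.
move=> [mg gi].
pose f_ n x := (g x ^+ 2 - Num.min (g x ^+ 2) n%:R)%R%:E.
have -> : 0%E = (\int[mu]_(x in D) cst 0%E x)%E :> \bar R by rewrite integral0.
have mf n : measurable_fun D (f_ n).
  apply/measurable_EFinP/measurable_funB; first exact: measurable_funX.
  by apply: measurable_minr => //; exact: measurable_funX.
have [] // := @dominated_convergence _ _ _ mu D mD f_ (cst 0%E) _ mf _ _ gi _.
- apply: aeW => x Dx; apply: cvg_near_cst; near=> n.
  rewrite /f_ min_l ?subrr//.
  by near: n; exact: nbhs_infty_ger.
- apply: aeW => x n Dx; rewrite /f_ /= lee_fin.
  have := sqr_ge0 (g x); have : (0 : R) <= n%:R by [].
  by move: (n%:R : R) (g x ^+ 2) => m t m0 t0; rewrite ger0_norm; case: (leP t m); lra.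
Unshelve. all: by end_near. Qed.

(** The difference is [H (w_ n) * (g_ n - g)] plus [(H (w_ n) - H w) * g]. The first term is
    controlled by [H <= 1]. In the second, [g ^+ 2] is cut at a height [K]: below it the Lipschitz
    bound gives a multiple of the squared distance from [w_ n] to [w], and on the excess the
    increment of [H] is at most 1, so [truncation_cvg0] applies. *)
Lemma cvg_L2_compM (H : R -> R) (w_ g_ : nat -> T -> R) w g :
  measurable_fun setT H -> (forall t, 0 <= H t <= 1) ->
  (forall s t, `|H s - H t| <= `|s - t|) ->
  (forall n, measurable_fun D (w_ n)) -> measurable_fun D w ->
  (forall n, measurable_fun D (g_ n)) -> L2 mu D g ->
  cvg_L2 mu D w_ w -> cvg_L2 mu D g_ g ->
  cvg_L2 mu D (fun n x => H (w_ n x) * g_ n x) (fun x => H (w x) * g x).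
Proof.
move=> mH H01 HL mw_ mw mg_ Lg cw cg; have mg : measurable_fun D g by case: Lg.
have mHw_ n : measurable_fun D (fun x => H (w_ n x)) by exact: measurableT_comp.
have mHw : measurable_fun D (fun x => H (w x)) by exact: measurableT_comp.
pose r n x := (H (w_ n x) - H (w x)) * g x.
have mr n : measurable_fun D (r n).
  by apply: measurable_funM => //; exact: measurable_funB.
have cr : sqint (r n) @[n --> \oo] --> 0%E.
  apply/ge0_cvge0P => [n|e e0]; first exact: sqint_ge0.
  have e20 : 0 < e / 2 by lra.
  have tge0 K x : 0 <= g x ^+ 2 - Num.min (g x ^+ 2) K%:R :> R.
    by case: (leP (g x ^+ 2) K%:R); lra.
  have := (ge0_cvge0P _).1 (truncation_cvg0 Lg) _ e20.
  case=> [n|K _ /(_ K (leqnn K)) hK].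
    by apply: integral_ge0 => x _; rewrite lee_fin.
  (* The successor keeps the divisor positive, since the truncation height [K] may be 0. *)
  have K10 : 0 < K.+1%:R :> R by [].
  have := (ge0_cvge0P (fun n => sqint_ge0 _)).1 cw (e / 2 / K.+1%:R).
  rewrite divr_gt0// => /(_ isT); apply: filterS => n hn.
  apply: (@le_trans _ _ (K.+1%:R%:E * sqint (fun x => w_ n x - w x)%R +
      1%:E * \int[mu]_(x in D) (g x ^+ 2 - Num.min (g x ^+ 2) K%:R)%R%:E)%E).
    apply: le_integral_lin => //.
    - by move=> x _; exact: sqr_ge0.
    - by move=> x _; exact: sqr_ge0.
    - exact: measurable_funX.
    - by apply: measurable_funX; exact: measurable_funB.
    - apply: measurable_funB; first exact: measurable_funX.
      by apply: measurable_minr => //; exact: measurable_funX.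
    - move=> x Dx; rewrite /r exprMn mul1r.
      have H1 : (H (w_ n x) - H (w x)) ^+ 2 <= 1.
        by have /andP[? ?] := H01 (w_ n x); have /andP[? ?] := H01 (w x); nra.
      have H2 : (H (w_ n x) - H (w x)) ^+ 2 <= (w_ n x - w x) ^+ 2.
        rewrite -(real_normK (num_real (H _ - _))).
        by rewrite -(real_normK (num_real (w_ n x - _))) lerXn2r ?nnegrE.
      have m0 : 0 <= Num.min (g x ^+ 2) K%:R by rewrite le_min sqr_ge0/=.
      have mK : Num.min (g x ^+ 2) K%:R <= K.+1%:R.
        by rewrite ge_min ler_nat leqnSn orbT.
      have := tge0 K x; move: H1 H2 m0 mK (sqr_ge0 (H (w_ n x) - H (w x))).
      move: ((H _ - _) ^+ 2) ((w_ n x - _) ^+ 2) (g x ^+ 2) (Num.min (g x ^+ 2) K%:R).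
      move: (K.+1%:R) K10 => k k0 dd ww gg m dd1 ddww m0 mk dd0 mgg.
      (* The three products add up to [k * ww + (gg - m) - dd * gg], whose nonnegativity is the
         goal. *)
      have : 0 <= dd * (k - m) by apply: mulr_ge0 => //; lra.
      have : 0 <= (1 - dd) * (gg - m) by apply: mulr_ge0 => //; lra.
      have : 0 <= (ww - dd) * k by apply: mulr_ge0; lra.
      by lra.
  rewrite mul1e; have -> : e = K.+1%:R * (e / 2 / K.+1%:R) + e / 2.
    by rewrite mulrC divfK ?gt_eqF//; lra.
  by rewrite EFinD leeD// [leRHS]EFinM lee_pmul2l// lte_fin.
apply: cvge0_le (cvge0_lin 2 2 cg cr) => n; rewrite sqint_ge0/=.
apply: sqint_lin => //.
- by apply: measurable_funB; exact: measurable_funM.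
- exact: measurable_funB.
- move=> x Dx; rewrite /r.
  set a := H (w_ n x); set b := H (w x).
  have -> : a * g_ n x - b * g x = a * (g_ n x - g x) + (a - b) * g x by ring.
  have := sqr_ge0 (a * (g_ n x - g x) - (a - b) * g x).
  have : (a * (g_ n x - g x)) ^+ 2 <= (g_ n x - g x) ^+ 2.
    rewrite exprMn ler_piMl ?sqr_ge0//; have := H01 (w_ n x); rewrite -/a => /andP[? ?].
    by nra.
  by set s := a * _; set t := (a - b) * _; nra.
Qed.

End L2_theory.

(** * Measurability, slices and integrability of continuous functions on the plane *)

Section continuous_on_the_plane.
Variable R : realType.
Implicit Types (f : R * R -> R) (p : R * R) (t : R) (U : set (R * R)).
(* The sigma-algebra on which [leb2] is defined; the canonical one on R * R has
   another display, and does not unify with it. *)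
Local Notation plane := (measurableTypeR R * measurableTypeR R)%type.

(** The sigma-algebra is the product one, so an open set has to be written as a countable union of
    boxes. Boxes with rational corners suffice; those not contained in [U] are replaced by the empty
    set, so that the index runs over a fixed countable type. *)
Lemma open_measurable_plane U : open U -> measurable (U : set plane).
Proof.
move=> oU.
pose box (q : (rat * rat) * (rat * rat)) : set (R * R) :=
  `]ratr q.1.1, ratr q.1.2[%classic `*` `]ratr q.2.1, ratr q.2.2[%classic.
pose F q : set plane := if `[< box q `<=` U >] then box q else set0.
have -> : U = \bigcup_q F q.
  apply/seteqP; split => [p Up|p [q _]]; last first.
    by rewrite /F; case: ifPn => // /asboolP; exact.
  have /nbhs_ballP[e /= e0 eU] : nbhs p U by exact: open_nbhs_nbhs.
  have rat_near t : exists q : rat * rat, ratr q.1 < t < ratr q.2 /\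
      (forall s, ratr q.1 < s < ratr q.2 -> ball t e s).
    have : t - e < t by rewrite ltrBlDr ltrDl.
    move=> /rat_in_itvoo[q1]; rewrite in_itv/= => /andP[q1a q1b].
    have : t < t + e by rewrite ltrDl.
    move=> /rat_in_itvoo[q2]; rewrite in_itv/= => /andP[q2a q2b].
    exists (q1, q2); split => /= [|s /andP[s1 s2]]; first by rewrite q1b q2a.
    by rewrite /ball/= ltr_distl; apply/andP; split; lra.
  have [q1 [p1 h1]] := rat_near p.1; have [q2 [p2 h2]] := rat_near p.2.
  exists (q1, q2) => //; rewrite /F asboolT; first by split; rewrite /= in_itv.
  by move=> s [/=]; rewrite !in_itv => s1 s2; apply: eU; split; [exact: h1|exact: h2].
apply: countable_bigcupT_measurable => // q; rewrite /F; case: ifPn => // _.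
by apply: measurableX; exact: measurable_itv.
Qed.

Lemma continuous_measurable_plane f : continuous f ->
  measurable_fun [set: plane] (f : plane -> R).
Proof.
move=> /continuousP cf; apply: (measurability _ (RGenOpens.measurableE R)).
move=> _ [_ [a [b ->] <-]]; rewrite setTI; apply: open_measurable_plane.
exact/cf/interval_open.
Qed.

Lemma continuous_slice_y f t : continuous f -> continuous (fun y => f (y, t)).
Proof.
move=> cf y; apply: (@continuous_comp _ _ _ (fun y => (y, t)) f); last exact: cf.
by apply: (@cvg_pair _ _ _ _ (nbhs y) (nbhs t)); [exact: cvg_id|exact: cvg_cst].
Qed.

Lemma continuous_slice_z f t : continuous f -> continuous (fun z => f (t, z)).
Proof.
move=> cf y; apply: (@continuous_comp _ _ _ (fun z => (t, z)) f); last exact: cf.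
by apply: (@cvg_pair _ _ _ _ (nbhs t) (nbhs y)); [exact: cvg_cst|exact: cvg_id].
Qed.

Lemma is_derive_slice_y f y z : derivable f (y, z) (1, 0) ->
  is_derive y 1 (fun t => f (t, z)) (dy f (y, z)).
Proof.
have E : (fun h : R => h^-1 *: (f (h *: 1 + y, z) - f (y, z))) =
    (fun h : R => h^-1 *: (f (h *: (1, 0) + (y, z)) - f (y, z))).
  apply/funext => h; congr (_ *: (f _ - _)).
  by rewrite (_ : h *: _ + _ = (h *: 1 + y, h *: 0 + z))// scaler0 add0r.
move=> df; apply: DeriveDef; first by rewrite /derivable E; exact: df.
by rewrite /derive E.
Qed.

Lemma is_derive_slice_z f y z : derivable f (y, z) (0, 1) ->
  is_derive z 1 (fun t => f (y, t)) (dz f (y, z)).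
Proof.
have E : (fun h : R => h^-1 *: (f (y, h *: 1 + z) - f (y, z))) =
    (fun h : R => h^-1 *: (f (h *: (0, 1) + (y, z)) - f (y, z))).
  apply/funext => h; congr (_ *: (f _ - _)).
  by rewrite (_ : h *: _ + _ = (h *: 0 + y, h *: 1 + z))// scaler0 add0r.
move=> df; apply: DeriveDef; first by rewrite /derivable E; exact: df.
by rewrite /derive E.
Qed.

Lemma FTC2_continuous_derive (F f : R -> R) (a b : R) : a < b ->
  (forall t, is_derive t 1 F (f t)) -> continuous f ->
  (\int[lebesgue_measure]_(t in `[a, b]) (f t)%:E = (F b - F a)%:E)%E.
Proof.
move=> ab dF cf; rewrite EFinB.
have cF : continuous F.
  move=> t; apply: differentiable_continuous; apply/derivable1_diffP.
  by case: (dF t).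
apply: continuous_FTC2 => //.
- exact: continuous_subspaceT.
- split => [t _||]; first by case: (dF t).
  + by apply: cvg_at_right_filter; exact: cF.
  + by apply: cvg_at_left_filter; exact: cF.
- by move=> t _; rewrite derive1E; case: (dF t).
Qed.

Lemma cont_bounded_support_integrable f (M : R) : continuous f ->
  (forall p, M < `|p.1| \/ M < `|p.2| -> f p = 0) ->
  L1 (leb2 R) setT f.
Proof.
move=> cf f0; rewrite /L1.
pose A : set plane := `[- M, M]%classic `*` `[- M, M]%classic.
have mA : measurable A by apply: measurableX; exact: measurable_itv.
have -> : EFin \o f = (EFin \o f) \_ A.
  apply/funext => p; rewrite patchE; case: ifPn => // /negP pA /=.
  rewrite f0//; apply: contrapT => /not_orP[p1 p2]; apply: pA; rewrite inE.
  by split; rewrite /= in_itv/= -ler_norml leNgt; exact/negP.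
have := @integrable_mkcond _ _ _ (leb2 R) A (EFin \o f) mA.
move=> [+ _]; apply; apply: measurable_bounded_integrable => //.
- have mI : measurable (`[- M, M]%classic : set (measurableTypeR R)).
    exact: measurable_itv.
  have fI : (leb1 R `[(- M)%R, M]%classic < +oo)%E.
    by apply: compact_finite_measure; exact: segment_compact.
  apply: (eq_ind_r (fun x => (x < +oo)%E) _
    (product_measure1E lebesgue_measure lebesgue_measure mI mI)).
  by apply: lte_mul_pinfty => //; rewrite ge0_fin_numE.
- by apply: measurable_funTS; exact: continuous_measurable_plane.
- have cA : compact (A : set (R * R)) by apply: compact_setX; exact: segment_compact.
  have /compact_bounded[K [_ hK]] : compact (f @` A).
    by apply: continuous_compact => //; exact: continuous_subspaceT.
  by exists K; split; [exact: num_real|move=> x Kx p Ap; apply: (hK _ Kx); exists p].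
Qed.

End continuous_on_the_plane.

(** * Integration by parts for C^1 functions *)

Section integrals_of_C1c_functions.
Variable R : realType.
Implicit Types (f h : R * R -> R) (M y z : R).
Local Notation line := (measurableTypeR R).
Local Notation plane := (line * line)%type.

Lemma integral_derive_compact (F f : R -> R) M : 0 < M ->
  (forall t : R, is_derive t (1 : R) F (f t)) -> continuous f ->
  (forall t, M <= `|t| -> F t = 0 /\ f t = 0) ->
  (\int[leb1 R]_t (f t)%:E = 0)%E.
Proof.
move=> M0 dF cf F0.
have -> : (fun t : line => (f t)%:E) = (fun t => (f t)%:E) \_ `[- M, M]%classic.
  apply/funext => t; rewrite patchE; case: ifPn => // /negP tM.
  have [|_ ->//] := F0 t; rewrite leNgt; apply/negP => tM'; apply: tM.
  by rewrite inE/= in_itv/= -ler_norml ltW.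
rewrite -integral_mkcond (FTC2_continuous_derive _ dF cf); last by lra.
have [|-> _] := F0 M; first by rewrite ger0_norm// ltW.
have [|-> _] := F0 (- M); first by rewrite normrN ger0_norm// ltW.
by rewrite subr0.
Qed.

Lemma dy_L1 h : C1c h -> L1 (leb2 R) setT (dy h).
Proof.
move=> Ch; have [M M0 hM] := C1c_bounded_support Ch.
have [/Ck1P[_ _ _ chy _] _] := Ch.
by apply: (cont_bounded_support_integrable (M := M)) => // p /hM; exact: derive_out.
Qed.

Lemma dz_L1 h : C1c h -> L1 (leb2 R) setT (dz h).
Proof.
move=> Ch; have [M M0 hM] := C1c_bounded_support Ch.
have [/Ck1P[_ _ _ _ chz] _] := Ch.
by apply: (cont_bounded_support_integrable (M := M)) => // p /hM; exact: derive_out.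
Qed.

Lemma integral_dy_C1c h : C1c h -> \int[leb2 R]_(p in setT) dy h p = 0.
Proof.
move=> Ch; have [M M0 hM] := C1c_bounded_support Ch.
have [/Ck1P[ch hy _ chy _] _] := Ch.
have := integral21_prod_meas1 (dy_L1 Ch); rewrite /Rintegral => <-.
rewrite [X in fine X](_ : _ = 0%E)//; apply: integral0_eq => z _.
(* The bound [M + 1] turns the strict inequality required by [hM] into a non-strict one. *)
apply: (@integral_derive_compact (fun y => h (y, z)) _ (M + 1)).
- by lra.
- by move=> y; apply: is_derive_slice_y; exact: hy.
- exact: (@continuous_slice_y _ (dy h)).
- move=> t Mt; have hs : ~ tsupport h (t, z) by apply: hM; left => /=; lra.
  by rewrite (tsupport_eq0 hs) /dy (derive_out _ hs).
Qed.

Lemma integral_dz_C1c h : C1c h -> \int[leb2 R]_(p in setT) dz h p = 0.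
Proof.
move=> Ch; have [M M0 hM] := C1c_bounded_support Ch.
have [/Ck1P[ch _ hz _ chz] _] := Ch.
have := integral12_prod_meas1 (dz_L1 Ch); rewrite /Rintegral => <-.
rewrite [X in fine X](_ : _ = 0%E)//; apply: integral0_eq => y _.
apply: (@integral_derive_compact (fun z => h (y, z)) _ (M + 1)).
- by lra.
- by move=> z; apply: is_derive_slice_z; exact: hz.
- exact: (@continuous_slice_z _ (dz h)).
- move=> t Mt; have hs : ~ tsupport h (y, t) by apply: hM; right => /=; lra.
  by rewrite (tsupport_eq0 hs) /dz (derive_out _ hs).
Qed.

Lemma Rintegral_support (D : set plane) (f : plane -> R) :
  (forall p, ~ D p -> f p = 0) ->
  \int[leb2 R]_(p in D) f p = \int[leb2 R]_(p in setT) f p.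
Proof.
move=> f0; rewrite Rintegral_mkcond; congr Rintegral; apply/funext => p.
by rewrite patchE; case: ifPn => // /negP; rewrite inE => /f0 ->.
Qed.

Lemma test_function_C1c (D : set plane) phi :
  test_function D phi -> C1c phi /\ tsupport phi `<=` D.
Proof. by move=> [Cphi cphi sphi]; split=> //; split=> //; exact: Cphi. Qed.

Lemma L1S (D : set plane) (f : plane -> R) : measurable D ->
  L1 (leb2 R) setT f -> L1 (leb2 R) D f.
Proof. by move=> mD; apply: integrableS. Qed.

Lemma C1M_L1 (f g : R * R -> R) : continuous f -> C1c g ->
  L1 (leb2 R) setT (fun p => f p * g p).
Proof.
move=> cf Cg; have [M M0 hM] := C1c_bounded_support Cg.
have [/Ck1P[cg _ _ _ _] _] := Cg.
apply: (cont_bounded_support_integrable (M := M)).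
  by move=> p; apply: cvgM; [exact: cf|exact: cg].
by move=> p /hM/tsupport_eq0 ->; rewrite mulr0.
Qed.

Lemma C1Mdy_L1 (f g : R * R -> R) : continuous f -> C1c g ->
  L1 (leb2 R) setT (fun p => f p * dy g p).
Proof.
move=> cf Cg; have [M M0 hM] := C1c_bounded_support Cg.
have [/Ck1P[_ _ _ cg _] _] := Cg.
apply: (cont_bounded_support_integrable (M := M)).
  by move=> p; apply: cvgM; [exact: cf|exact: cg].
by move=> p /hM gp; rewrite /dy (derive_out _ gp) mulr0.
Qed.

Lemma C1Mdz_L1 (f g : R * R -> R) : continuous f -> C1c g ->
  L1 (leb2 R) setT (fun p => f p * dz g p).
Proof.
move=> cf Cg; have [M M0 hM] := C1c_bounded_support Cg.
have [/Ck1P[_ _ _ _ cg] _] := Cg.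
apply: (cont_bounded_support_integrable (M := M)).
  by move=> p; apply: cvgM; [exact: cf|exact: cg].
by move=> p /hM gp; rewrite /dz (derive_out _ gp) mulr0.
Qed.

(** The test function and its derivatives vanish off [D], so all integrals extend to the whole
    plane. There the two sides differ by the integral of a derivative of [f \* phi], which is 0: the
    product has compact support even where [f] has not. *)
Lemma C1_weak_gradient (D : set (R * R)) f :
  Ck 1 f -> weak_gradient D f (fun p => (dy f p, dz f p)).
Proof.
move=> Cf phi /test_function_C1c[Cphi sphi].
have [/Ck1P[cphi phiy phiz _ _] _] := Cphi.
have /Ck1P[cf fy fz cfy cfz] := Cf.
have out p : ~ D p -> ~ tsupport phi p by move=> Dp /sphi.
split.
- have e1 : \int[leb2 R]_(p in D) (f p * dy phi p) =
      \int[leb2 R]_(p in setT) (f p * dy phi p).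
    by apply: Rintegral_support => p /out pp; rewrite /dy (derive_out _ pp) mulr0.
  have e2 : \int[leb2 R]_(p in D) (dy f p * phi p) =
      \int[leb2 R]_(p in setT) (dy f p * phi p).
    by apply: Rintegral_support => p /out/tsupport_eq0 ->; rewrite mulr0.
  apply: (etrans e1); apply: (etrans _ (congr1 -%R (esym e2))).
  apply/eqP; rewrite -addr_eq0 -RintegralD//; [|exact: C1Mdy_L1|exact: C1M_L1].
  rewrite -(integral_dy_C1c (C1cM Cf Cphi)); apply/eqP/eq_Rintegral => p _.
  by rewrite dyM.
- have e1 : \int[leb2 R]_(p in D) (f p * dz phi p) =
      \int[leb2 R]_(p in setT) (f p * dz phi p).
    by apply: Rintegral_support => p /out pp; rewrite /dz (derive_out _ pp) mulr0.
  have e2 : \int[leb2 R]_(p in D) (dz f p * phi p) =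
      \int[leb2 R]_(p in setT) (dz f p * phi p).
    by apply: Rintegral_support => p /out/tsupport_eq0 ->; rewrite mulr0.
  apply: (etrans e1); apply: (etrans _ (congr1 -%R (esym e2))).
  apply/eqP; rewrite -addr_eq0 -RintegralD//; [|exact: C1Mdz_L1|exact: C1M_L1].
  rewrite -(integral_dz_C1c (C1cM Cf Cphi)); apply/eqP/eq_Rintegral => p _.
  by rewrite dzM.
Qed.

Lemma C1c_L2 (D : set plane) f : measurable D -> C1c f -> L2 (leb2 R) D f.
Proof.
move=> mD Cf; have [/Ck1P[cf _ _ _ _] _] := Cf; split.
  by apply: measurable_funTS; exact: continuous_measurable_plane.
exact: (L1S mD (C1M_L1 cf Cf)).
Qed.

Lemma dy_L2 (D : set plane) f : measurable D -> C1c f -> L2 (leb2 R) D (dy f).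
Proof.
move=> mD Cf; have [/Ck1P[_ _ _ cf _] _] := Cf; split.
  by apply: measurable_funTS; exact: continuous_measurable_plane.
exact: (L1S mD (C1Mdy_L1 cf Cf)).
Qed.

Lemma dz_L2 (D : set plane) f : measurable D -> C1c f -> L2 (leb2 R) D (dz f).
Proof.
move=> mD Cf; have [/Ck1P[_ _ _ _ cf] _] := Cf; split.
  by apply: measurable_funTS; exact: continuous_measurable_plane.
exact: (L1S mD (C1Mdz_L1 cf Cf)).
Qed.

End integrals_of_C1c_functions.

(** * Poincare inequality in the y direction, with boundary terms *)

Section poincare.
Variable R : realType.
Implicit Types (f : R * R -> R) (y z : R).
Local Notation line := (measurableTypeR R).
Local Notation plane := (line * line)%type.

Lemma measurable_Omega : measurable (@Omega R : set plane).
Proof. by apply: measurableX; exact: measurable_itv. Qed.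

Lemma integral_setX_slices (A B : set line) (f : plane -> R) :
  measurable A -> measurable B -> measurable_fun [set: plane] f ->
  (forall p, 0 <= f p) ->
  (\int[leb2 R]_(p in A `*` B) (f p)%:E =
   \int[leb1 R]_(z in B) \int[leb1 R]_(y in A) (f (y, z))%:E)%E /\
  measurable_fun B (fun z => \int[leb1 R]_(y in A) (f (y, z))%:E)%E.
Proof.
move=> mA mB mf f0; have mAB : measurable (A `*` B : set plane) by exact: measurableX.
have mAT : measurable (A `*` setT : set plane) by exact: measurableX.
have mf' : measurable_fun [set: plane] (EFin \o f : plane -> \bar R).
  exact/measurable_EFinP.
split; last first.
  apply: measurable_funTS.
  pose g : plane -> \bar R := (EFin \o f) \_ (A `*` setT).
  have mg : measurable_fun setT g.
    have [h _] := measurable_restrictT (EFin \o f : plane -> \bar R) mAT.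
    exact: h (measurable_funTS mf').
  have g0 p : (0 <= g p)%E by rewrite /g patchE; case: ifPn; rewrite ?lee_fin.
  have := @measurable_fun_fubini_tonelli_G _ _ _ _ _ (@lebesgue_measure R) g mg g0.
  congr measurable_fun; apply/funext => z; rewrite /fubini_G [RHS]integral_mkcond.
  apply: eq_integral => y _; rewrite /g !patchE.
  by rewrite in_setX in_setT andbT.
pose g : plane -> \bar R := (EFin \o f) \_ (A `*` B).
have mg : measurable_fun setT g.
  have [h _] := measurable_restrictT (EFin \o f : plane -> \bar R) mAB.
    exact: h (measurable_funTS mf').
have g0 p : (0 <= g p)%E by rewrite /g patchE; case: ifPn; rewrite ?lee_fin.
rewrite integral_mkcond.
have := @fubini_tonelli2 _ _ _ _ _
  (@lebesgue_measure R) (@lebesgue_measure R) g mg g0.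
move=> ->; rewrite [RHS]integral_mkcond; apply: eq_integral => z _.
rewrite /fubini_G [RHS]patchE; case: ifPn => zB.
  rewrite [RHS]integral_mkcond; apply: eq_integral => y _.
  by rewrite /g !patchE in_setX zB andbT.
by apply: integral0_eq => y _; rewrite /g patchE in_setX (negbTE zB) andbF.
Qed.

(** The weight [t] has derivative 1 and equals -1 and 1 at the endpoints, so integrating the
    derivative [g] of [t * F t ^+ 2] yields the sum of the two boundary squares. They are kept
    because the approximating functions have small but possibly nonzero boundary values. *)
Lemma poincare_line (F f : R -> R) :
  (forall t : R, is_derive t (1 : R) F (f t)) -> continuous f ->
  (\int[leb1 R]_(t in `](- 1)%R, 1%R[) (F t ^+ 2)%:E <=
   (2 * (F (-1) ^+ 2 + F 1 ^+ 2))%R%:E +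
   4%:E * \int[leb1 R]_(t in `](- 1)%R, 1%R[) (f t ^+ 2)%:E)%E.
Proof.
move=> dF cf.
have cF : continuous F.
  move=> t; apply: differentiable_continuous; apply/derivable1_diffP.
  by case: (dF t).
pose g t := F t ^+ 2 + 2 * t * (F t * f t).
have dG t : is_derive t (1 : R) (fun s => s * F s ^+ 2) (g t).
  have [dFt eFt] := dF t.
  have -> : (fun s => s * F s ^+ 2) = id * (F * F).
    by apply/funext => s; rewrite expr2.
  apply: (is_derive_eq (is_deriveM (is_derive_id t 1) (is_deriveM (dF t) (dF t)))).
  by rewrite (_ : _ + _ = t * (F t * f t + F t * f t) + F t * F t * 1)// /g; ring.
have cFX (h : R -> R) : continuous h -> continuous (fun t => h t ^+ 2).
  by move=> ch t; rewrite /continuous_at; apply: (cvgM (ch t) (ch t)).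
have cg : continuous g.
  move=> t; apply: cvgD; first exact: cFX.
  apply: cvgM; last by apply: cvgM; [exact: cF|exact: cf].
  by apply: cvgM; [exact: cvg_cst|exact: cvg_id].
have int h : continuous h -> (leb1 R).-integrable `[-1, 1] (EFin \o h).
  move=> ch; apply: continuous_compact_integrable; first exact: segment_compact.
  exact: continuous_subspaceT.
have closed h : continuous h -> (\int[leb1 R]_(t in `](- 1)%R, 1%R[) (h t)%:E =
    \int[leb1 R]_(t in `[(- 1)%R, 1%R]) (h t)%:E)%E.
  move=> ch; apply/esym; apply: integral_itv_bndoo; apply/measurable_EFinP.
  by apply: measurable_funTS; exact: continuous_measurable_fun.
rewrite !closed; [|exact: cFX|exact: cFX].
have -> : 2 * (F (-1) ^+ 2 + F 1 ^+ 2) =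
    2 * (1 * F 1 ^+ 2 - (-1) * F (-1) ^+ 2) by ring.
rewrite EFinM -(FTC2_continuous_derive _ dG cg); last by lra.
rewrite -!integralZl//; [|exact: int (cFX _ cf)|exact: int].
rewrite -integralD//; last 2 first.
- by apply: integrableZl => //; exact: int.
- by apply: integrableZl => //; exact: int (cFX _ cf).
apply: le_integral => //.
- exact: int (cFX _ cF).
- apply: integrableD => //; apply: integrableZl => //; first exact: int.
  exact: int (cFX _ cf).
- move=> t; rewrite inE/= in_itv/= => /andP[t1 t2].
  rewrite -!EFinM -EFinD lee_fin /g.
  (* Source of the constants 2 and 4: [2 * g t + 4 * f t ^+ 2 - F t ^+ 2] equals [(F t + 2 * t * f
     t) ^+ 2 + 4 * ((1 - t ^+ 2) * f t ^+ 2)], where |t| <= 1. *)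
  have : 0 <= (1 - t ^+ 2) * f t ^+ 2 by apply: mulr_ge0; [nra|exact: sqr_ge0].
  by have := sqr_ge0 (F t + 2 * t * f t); lra.
Qed.

(* Integrates d/dy (y f^2) over -1 < y < 1. *)
Lemma poincare_C1 f : Ck 1 f ->
  (sqint (leb2 R) (@Omega R) f <=
   2%:E * (sqint (leb1 R) (@neg_line R) (fun z => f ((-1)%R, z)) +
           sqint (leb1 R) (@neg_line R) (fun z => f (1%R, z))) +
   4%:E * sqint (leb2 R) (@Omega R) (dy f))%E.
Proof.
move=> /Ck1P[cf fy _ cfy _].
have mneg : measurable (@neg_line R : set line) by exact: measurable_itv.
have mI : measurable (`]-1, 1[%classic : set line) by exact: measurable_itv.
have msq (g : R * R -> R) : continuous g ->
    measurable_fun [set: plane] (fun p : plane => g p ^+ 2).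
  by move=> cg; apply: measurable_funX; exact: continuous_measurable_plane.
have mbd s : measurable_fun (@neg_line R) (fun z : line => f (s, z)).
  apply: measurable_funTS; apply: continuous_measurable_fun.
  exact: continuous_slice_z.
have [E1 M1] := integral_setX_slices mI mneg (msq _ cf) (fun p => sqr_ge0 _).
have [E2 M2] := integral_setX_slices mI mneg (msq _ cfy) (fun p => sqr_ge0 _).
rewrite /sqint E1 E2.
have b0 s z : (0 <= (f (s, z) ^+ 2)%:E)%E by rewrite lee_fin sqr_ge0.
have i0 z : (0 <= \int[leb1 R]_(y in `](- 1)%R, 1%R[) (dy f (y, z) ^+ 2)%:E)%E.
  by apply: integral_ge0 => y _; rewrite lee_fin sqr_ge0.
have mb s : measurable_fun (@neg_line R)
    ((fun z : line => (f (s, z) ^+ 2)%:E) : line -> \bar R).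
  by apply/measurable_EFinP/measurable_funX.
have mbb := emeasurable_funD (mb (-1)) (mb 1).
have b1 z : (0 <= (f ((-1)%R, z) ^+ 2)%:E + (f (1%R, z) ^+ 2)%:E)%E.
  exact: adde_ge0.
rewrite -(ge0_integralD lebesgue_measure mneg (fun z _ => b0 _ z) (mb (-1))
  (fun z _ => b0 _ z) (mb 1)).
rewrite -(ge0_integralZl lebesgue_measure mneg mbb (fun z _ => b1 z))//.
rewrite -(ge0_integralZl lebesgue_measure mneg M2 (fun z _ => i0 z))//.
rewrite -(ge0_integralD lebesgue_measure mneg _ (measurable_funeM 2%:E mbb) _
  (measurable_funeM 4%:E M2));
  [|by move=> z _; apply: mule_ge0..].
apply: ge0_le_integral => //.
- by move=> z _; apply: integral_ge0 => y _; rewrite lee_fin sqr_ge0.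
- by apply: emeasurable_funD; apply: measurable_funeM.
- move=> z _; rewrite -EFinD -EFinM.
  apply: (@poincare_line (fun y => f (y, z)) (fun y => dy f (y, z))).
    by move=> y; apply: is_derive_slice_y; exact: fy.
  exact: (@continuous_slice_y _ (dy f)).
Qed.

End poincare.

(** * Functions with zero trace as limits of C^1 functions *)

Section zero_trace_approximation.
Variable R : realType.
Local Notation line := (measurableTypeR R).
Local Notation plane := (line * line)%type.
Local Notation Omega := (@Omega R).
Implicit Types (f g gy gz : R * R -> R) (w a b : nat -> R * R -> R).

(** The condition of [is_trace] for zero boundary values, stated for bare functions: it can then be
    established for a composition with [spos] before that is known to have a weak gradient, that is,
    before it is an element of [W12]. *)
Definition zero_trace_approx f gy gz w : Prop :=
  [/\ forall n, C1c (w n), cvg_L2 (leb2 R) Omega w f,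
      cvg_L2 (leb2 R) Omega (fun n => dy (w n)) gy,
      cvg_L2 (leb2 R) Omega (fun n => dz (w n)) gz &
      forall s : R, s = -1 \/ s = 1 ->
        cvg_L2 (leb1 R) (@neg_line R) (fun n z => w n (s, z)) (fun=> 0)].

Let mO := @measurable_Omega R.

Let mneg : measurable (@neg_line R : set line).
Proof. exact: measurable_itv. Qed.

Let mC1 f : C1c f -> measurable_fun Omega (f : plane -> R).
Proof. by move=> /(C1c_L2 mO)[]. Qed.

Let mdy f : C1c f -> measurable_fun Omega (dy f : plane -> R).
Proof. by move=> /(dy_L2 mO)[]. Qed.

Let mdz f : C1c f -> measurable_fun Omega (dz f : plane -> R).
Proof. by move=> /(dz_L2 mO)[]. Qed.

Let mslice f s : C1c f -> measurable_fun (@neg_line R) (fun z : line => f (s, z)).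
Proof.
move=> [/Ck1P[cf _ _ _ _] _]; apply: measurable_funTS.
by apply: continuous_measurable_fun; exact: continuous_slice_z.
Qed.

Lemma zero_trace_approxB f fy fz a g gy gz b :
  L2 (leb2 R) Omega f -> L2 (leb2 R) Omega fy -> L2 (leb2 R) Omega fz ->
  L2 (leb2 R) Omega g -> L2 (leb2 R) Omega gy -> L2 (leb2 R) Omega gz ->
  zero_trace_approx f fy fz a -> zero_trace_approx g gy gz b ->
  zero_trace_approx (fun p => f p - g p) (fun p => fy p - gy p)
    (fun p => fz p - gz p) (fun n => a n \- b n).
Proof.
move=> [mf _] [mfy _] [mfz _] [mg _] [mgy _] [mgz _].
move=> [Ca af afy afz a0] [Cb bg bgy bgz b0].
have dyE : (fun n => dy (a n \- b n)) = (fun n p => dy (a n) p - dy (b n) p).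
  apply/funext => n; apply/funext => p; apply: dyB.
    by have [/Ck1P[]] := Ca n.
  by have [/Ck1P[]] := Cb n.
have dzE : (fun n => dz (a n \- b n)) = (fun n p => dz (a n) p - dz (b n) p).
  apply/funext => n; apply/funext => p; apply: dzB.
    by have [/Ck1P[]] := Ca n.
  by have [/Ck1P[]] := Cb n.
split.
- by move=> n; exact: C1cB.
- by apply: cvg_L2B => // n; exact: mC1.
- by rewrite dyE; apply: cvg_L2B => // n; exact: mdy.
- by rewrite dzE; apply: cvg_L2B => // n; exact: mdz.
- move=> s s1; have -> : (fun _ : line => 0) = (fun _ : line => 0 - 0 : R).
    by rewrite subr0.
  by apply: cvg_L2B (a0 s s1) (b0 s s1) => // n; exact: mslice.
Qed.

Lemma measurable_clamp01 : measurable_fun [set: R] (@clamp01 R).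
Proof. by apply: continuous_measurable_fun; exact: continuous_clamp01. Qed.

Lemma measurable_spos : measurable_fun [set: R] (@spos R).
Proof. by apply: continuous_measurable_fun; exact: continuous_spos. Qed.

Let mspos (f : plane -> R) : measurable_fun Omega f ->
  measurable_fun Omega (fun p : plane => spos (f p)).
Proof. exact: (measurableT_comp measurable_spos). Qed.

Let mclamp (f : plane -> R) : measurable_fun Omega f ->
  measurable_fun Omega (fun p : plane => clamp01 (f p)).
Proof. exact: (measurableT_comp measurable_clamp01). Qed.

Lemma spos_L2 f : L2 (leb2 R) Omega f -> L2 (leb2 R) Omega (@spos R \o f).
Proof.
move=> Lf; have [mf _] := Lf; apply: (L2_le mO _ Lf).
  exact: mspos.
by move=> p _ /=; have := spos_lip (f p) 0; rewrite spos0 !subr0.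
Qed.

Lemma clamp01M_L2 f g : L2 (leb2 R) Omega f -> L2 (leb2 R) Omega g ->
  L2 (leb2 R) Omega (fun p => clamp01 (f p) * g p).
Proof.
move=> [mf _] Lg; have [mg _] := Lg; apply: (L2_le mO _ Lg).
  by apply: measurable_funM mg; exact: mclamp.
move=> p _ /=; rewrite normrM ler_piMl// ger0_norm ?clamp01_ge0//.
exact: clamp01_le1.
Qed.

(** The chain rule is classical for each [w n]. Values and boundary values converge because [spos]
    is 1-Lipschitz and [spos 0 = 0], derivatives by [cvg_L2_compM]. *)
Lemma zero_trace_approx_spos f gy gz w :
  L2 (leb2 R) Omega f -> L2 (leb2 R) Omega gy -> L2 (leb2 R) Omega gz ->
  zero_trace_approx f gy gz w ->
  zero_trace_approx (@spos R \o f) (fun p => clamp01 (f p) * gy p)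
    (fun p => clamp01 (f p) * gz p) (fun n => @spos R \o w n).
Proof.
move=> Lf Lgy Lgz [Cw wf wgy wgz w0].
have [mf _] := Lf; have [mgy _] := Lgy; have [mgz _] := Lgz.
have c01 (t : R) : 0 <= clamp01 t <= 1 by rewrite clamp01_ge0 clamp01_le1.
have mw n : measurable_fun Omega (w n : plane -> R) by exact: mC1.
have dyE : (fun n => dy (@spos R \o w n)) = (fun n p => clamp01 (w n p) * dy (w n) p).
  apply/funext => n; apply/funext => p; apply: dy_spos.
  by have [/Ck1P[]] := Cw n.
have dzE : (fun n => dz (@spos R \o w n)) = (fun n p => clamp01 (w n p) * dz (w n) p).
  apply/funext => n; apply/funext => p; apply: dz_spos.
  by have [/Ck1P[]] := Cw n.
have lip := @clamp01_lip R; have mc := measurable_clamp01.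
split.
- by move=> n; exact: C1c_spos.
- rewrite cvg_L2E; apply: cvge0_le wf => n; rewrite sqint_ge0/=.
  apply: sqint_le => //.
  + by apply: measurable_funB; exact: mspos.
  + exact: measurable_funB (mw n) mf.
  + by move=> p _; exact: spos_lip.
- by rewrite dyE; apply: cvg_L2_compM => // n; exact: mdy.
- by rewrite dzE; apply: cvg_L2_compM => // n; exact: mdz.
- move=> s s1; rewrite cvg_L2E; apply: cvge0_le (w0 s s1) => n.
  rewrite sqint_ge0/=; apply: sqint_le => //.
  + apply: measurable_funB => //; apply: (measurableT_comp measurable_spos).
    exact: mslice.
  + by apply: measurable_funB => //; exact: mslice.
  + by move=> z _ /=; rewrite -[X in _ - X](@spos0 R); exact: spos_lip.
Qed.

(** Both sides of the integration by parts formula for [w n] converge, and limits are unique. *)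
Lemma zero_trace_approx_weak_gradient f gy gz w :
  L2 (leb2 R) Omega f -> L2 (leb2 R) Omega gy -> L2 (leb2 R) Omega gz ->
  zero_trace_approx f gy gz w -> weak_gradient Omega f (fun p => (gy p, gz p)).
Proof.
move=> Lf Lgy Lgz [Cw wf wgy wgz w0] phi tphi.
have [Cphi _] := test_function_C1c tphi.
have Lphi := C1c_L2 mO Cphi.
have Ldy := dy_L2 mO Cphi; have Ldz := dz_L2 mO Cphi.
have Lw n := C1c_L2 mO (Cw n).
have Lwy n := dy_L2 mO (Cw n); have Lwz n := dz_L2 mO (Cw n).
have gw n := C1_weak_gradient (proj1 (Cw n)) tphi.
split.
- have c1 := cvg_L2_RintegralM mO Lw Lf Ldy wf.
  have c2 : (- \int[leb2 R]_(p in Omega) (dy (w n) p * phi p)) @[n --> \oo] -->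
      - \int[leb2 R]_(p in Omega) (gy p * phi p).
    by apply: cvgN; exact: cvg_L2_RintegralM.
  have E : (fun n => \int[leb2 R]_(p in Omega) (w n p * dy phi p)) =
      (fun n => - \int[leb2 R]_(p in Omega) (dy (w n) p * phi p)).
    by apply/funext => n; exact: (proj1 (gw n)).
  by rewrite E in c1; exact: (cvg_unique (@Rhausdorff R) c1 c2).
- have c1 := cvg_L2_RintegralM mO Lw Lf Ldz wf.
  have c2 : (- \int[leb2 R]_(p in Omega) (dz (w n) p * phi p)) @[n --> \oo] -->
      - \int[leb2 R]_(p in Omega) (gz p * phi p).
    by apply: cvgN; exact: cvg_L2_RintegralM.
  have E : (fun n => \int[leb2 R]_(p in Omega) (w n p * dz phi p)) =
      (fun n => - \int[leb2 R]_(p in Omega) (dz (w n) p * phi p)).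
    by apply/funext => n; exact: (proj2 (gw n)).
  by rewrite E in c1; exact: (cvg_unique (@Rhausdorff R) c1 c2).
Qed.

(** The Poincare inequality is applied to [w n], where boundary values make sense pointwise. Its
    right-hand side tends to 0, hence [w n] tends to 0 in L^2 as well as to [f]. *)
Lemma zero_trace_approx_eq0 f gy gz w :
  L2 (leb2 R) Omega f -> L2 (leb2 R) Omega gy ->
  zero_trace_approx f gy gz w -> sqint (leb2 R) Omega gy = 0%E ->
  ae_in Omega (fun p => f p = 0).
Proof.
move=> [mf _] [mgy _] [Cw wf wgy _ w0] gy0.
apply: (sqint0_ae mO mf).
apply: (cvg_L2_sqint0 mO _ mf wf) => [n|]; first exact: mC1.
have bd s : s = -1 \/ s = 1 ->
    sqint (leb1 R) (@neg_line R) (fun z => w n (s, z)) @[n --> \oo] --> 0%E.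
  move=> s1; have := w0 s s1; rewrite cvg_L2E.
  by under eq_fun do under eq_fun do rewrite subr0.
have dy0 : sqint (leb2 R) Omega (dy (w n)) @[n --> \oo] --> 0%E.
  by apply: (sqint0_cvg_L2 mO _ mgy wgy gy0) => n; exact: mdy.
have b2 := cvge0_lin 1 1 (bd (-1) (or_introl erefl)) (bd 1 (or_intror erefl)).
apply: cvge0_le (cvge0_lin 2 4 b2 dy0) => n; rewrite sqint_ge0/= !mul1e.
by apply: poincare_C1; case: (Cw n).
Qed.

End zero_trace_approximation.

(** * The test function and the monotonicity of the flux *)

Section comparison.
Variable R : realType.
Local Notation line := (measurableTypeR R).
Local Notation plane := (line * line)%type.
Local Notation Omega := (@Omega R).
Implicit Types (u v phi : W12 R) (q : R * R -> R * R).

Let mO := @measurable_Omega R.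

Let ae_filter : Filter (almost_everywhere (leb2 R : set plane -> \bar R)) :=
  ae_filter_ringOfSetsType (leb2 R : {measure set plane -> \bar R}).

Lemma ae_inS (D : set (R * R)) (P Q : R * R -> Prop) :
  (forall p, D p -> P p -> Q p) -> ae_in D P -> ae_in D Q.
Proof.
by move=> PQ; apply: (@filterS _ _ ae_filter) => p Pp Dp; exact: PQ (Pp Dp).
Qed.

Lemma ae_inI (D : set (R * R)) (P Q : R * R -> Prop) :
  ae_in D P -> ae_in D Q -> ae_in D (fun p => P p /\ Q p).
Proof.
by apply: (@filterS2 _ _ ae_filter) => p Pp Qp Dp; split; [exact: Pp|exact: Qp].
Qed.

Lemma dot_le_enorm (a b : R * R) : enorm a <= 1 -> dot a b <= enorm b.
Proof.
move=> a1; have a0 : 0 <= dot a a by rewrite /dot -!expr2 addr_ge0// sqr_ge0.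
have {}a1 : dot a a <= 1.
  by rewrite -(sqr_sqrtr a0) expr_le1// sqrtr_ge0.
rewrite (le_trans (ler_norm _))// -sqrtr_sqr ler_wsqrtr//.
have b0 : 0 <= dot b b by rewrite /dot -!expr2 addr_ge0// sqr_ge0.
apply: (@le_trans _ _ (dot a a * dot b b)); last by rewrite ler_piMl.
(* Lagrange's identity: the square is the gap in the Cauchy-Schwarz inequality. *)
by rewrite /dot; have := sqr_ge0 (a.1 * b.2 - a.2 * b.1); nra.
Qed.

(** [L2loc] gives measurability on compact subsets only, so Omega is exhausted by the closed
    rectangles [K n], which keep a distance of at least 1/(n+1) from its boundary. *)
Lemma Lambda_measurable q : Lambda q ->
  measurable_fun Omega (fun p : plane => (q p).1) /\
  measurable_fun Omega (fun p : plane => (q p).2).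
Proof.
move=> [ql _].
pose I (n : nat) : set R := `[- 1 + n.+1%:R^-1, 1 - n.+1%:R^-1]%classic.
pose J (n : nat) : set R := `[- n.+1%:R, - n.+1%:R^-1]%classic.
pose K n : set plane := I n `*` J n.
have mK n : measurable (K n) by apply: measurableX; exact: measurable_itv.
have i0 n : 0 < n.+1%:R^-1 :> R by rewrite invr_gt0.
have cK n : compact (K n : set (R * R)) by apply: compact_setX; exact: segment_compact.
have KOyz n (y z : R) : K n (y, z) -> Omega (y, z).
  rewrite /K /I /J /= => -[/=]; rewrite !in_itv/= => /andP[y1 y2] /andP[z1 z2].
  move: (i0 n) y1 y2 z2; move: (n.+1%:R^-1) => e e0 y1 y2 z2.
  split; [change (y \in `]-1, 1[)|change (z \in `]-oo, 0[)]; rewrite in_itv/=.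
    by apply/andP; split; lra.
  by lra.
have KO n : K n `<=` Omega by move=> [y z]; exact: KOyz.
have near_inv (e : R) : 0 < e -> \forall n \near \oo, n.+1%:R^-1 <= e.
  move=> e0; near=> n; rewrite invf_ple ?posrE//.
  apply: (@le_trans _ _ n%:R); last by rewrite ler_nat.
  by near: n; exact: nbhs_infty_ger.
have OKyz (y z : R) : Omega (y, z) -> exists n, K n (y, z).
  case; change (y \in `]-1, 1[ -> z \in `]-oo, 0[ -> exists n, K n (y, z)).
  rewrite !in_itv/= => /andP[y1 y2] z0.
  near \oo => n; exists n.
  have h1 : n.+1%:R^-1 <= y + 1 by near: n; apply: near_inv; lra.
  have h2 : n.+1%:R^-1 <= 1 - y by near: n; apply: near_inv; lra.
  have h3 : n.+1%:R^-1 <= - z by near: n; apply: near_inv; lra.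
  have h4 : - z <= n.+1%:R.
    apply: (@le_trans _ _ n%:R); last by rewrite ler_nat.
    by near: n; exact: nbhs_infty_ger.
  rewrite /K /I /J; move: (n.+1%:R^-1) h1 h2 h3 => e h1 h2 h3.
  by split; rewrite /= in_itv/=; apply/andP; split; lra.
have OE : Omega = \bigcup_n K n.
  apply/seteqP; split => [[y z] /OKyz[n Kn]|p [n _ /KO]//].
  by exists n.
have h n := ql _ (cK n) (KO n).
by rewrite OE; split; apply/(measurable_fun_bigcup _ mK) => n; case: (h n) => -[? _] [].
Unshelve. all: by end_near. Qed.

(** [weak_form] is a real-valued integral, so two of them can be subtracted under the integral sign
    only when the integrands are integrable. The first term is a sum of products of L^2 functions;
    in the second, |q| <= 1 leaves |z| times the components of [grad phi], integrable by
    [spaceX]. *)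
Lemma weak_form_integrable u q phi : spaceX phi -> Lambda q ->
  L1 (leb2 R) Omega (fun p =>
    dot (grad u p) (grad phi p) + `|p.2| * dot (q p) (grad phi p)).
Proof.
move=> [_ iy iz] Lq; have [mq1 mq2] := Lambda_measurable Lq; have [_ q1] := Lq.
have [mpy _] := grad_L2y phi; have [mpz _] := grad_L2z phi.
have i1 := L2_integrableM mO (grad_L2y u) (grad_L2y phi).
have i2 := L2_integrableM mO (grad_L2z u) (grad_L2z phi).
have mz : measurable_fun Omega (fun p : plane => `|p.2|).
  by apply: measurableT_comp => //; exact: measurable_funTS measurable_snd.
pose F (p : plane) := `|p.2| * dot (q p) (grad phi p).
have mF : measurable_fun Omega F.
  apply: measurable_funM mz _.
  apply: measurable_funD; exact: measurable_funM.
have iF : L1 (leb2 R) Omega F.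
  have := integrableD mO (integrable_norm iy) (integrable_norm iz).
  move=> /integrableP[mG fG]; apply/integrableP; split; first exact/measurable_EFinP.
  apply: le_lt_trans fG; apply: ae_ge0_le_integral => //.
  - by apply: measurableT_comp => //; exact/measurable_EFinP.
  - exact: measurableT_comp.
  apply: ae_inS q1 => p Op h; rewrite /= lee_fin /F.
  rewrite [leRHS]ger0_norm ?addr_ge0// !normrM normr_id -mulrDr ler_wpM2l//.
  have s1 : (q p).1 ^+ 2 + (q p).2 ^+ 2 <= 1.
    have a0 : 0 <= dot (q p) (q p) by rewrite /dot -!expr2 addr_ge0// sqr_ge0.
    by rewrite !expr2 -/(dot _ _) -(sqr_sqrtr a0) expr_le1// sqrtr_ge0.
  rewrite (le_trans (ler_normD _ _))// !normrM lerD// ler_piMl//.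
    by rewrite -(@expr_le1 _ 2)// real_normK ?num_real//; have := sqr_ge0 (q p).2; lra.
  by rewrite -(@expr_le1 _ 2)// real_normK ?num_real//; have := sqr_ge0 (q p).1; lra.
exact: (integrableD mO (integrableD mO i1 i2) iF).
Qed.

(** The last clause is the form in which the Poincare inequality enters the comparison. *)
Lemma spos_sub_spaceX u v : spaceX u -> spaceX v ->
  exists phi : W12 R, [/\ spaceX phi,
    forall p, phi p = spos (u p - v p),
    forall p, grad phi p = (clamp01 (u p - v p) * ((grad u p).1 - (grad v p).1),
                            clamp01 (u p - v p) * ((grad u p).2 - (grad v p).2)) &
    sqint (leb2 R) Omega (fun p => (grad phi p).1) = 0%E ->
      ae_in Omega (fun p => phi p = 0)].
Proof.
move=> [[_ [a [Ca au auy auz a0]]] iuy iuz] [[_ [b [Cb bv bvy bvz b0]]] ivy ivz].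
have Aa : zero_trace_approx u (fun p => (grad u p).1) (fun p => (grad u p).2) a.
  by split.
have Ab : zero_trace_approx v (fun p => (grad v p).1) (fun p => (grad v p).2) b.
  by split.
have Lu := fct_L2 u; have Luy := grad_L2y u; have Luz := grad_L2z u.
have Lv := fct_L2 v; have Lvy := grad_L2y v; have Lvz := grad_L2z v.
have Aw := zero_trace_approxB Lu Luy Luz Lv Lvy Lvz Aa Ab.
have Lw := L2B mO Lu Lv; have Lwy := L2B mO Luy Lvy; have Lwz := L2B mO Luz Lvz.
have As := zero_trace_approx_spos Lw Lwy Lwz Aw.
have Lf := spos_L2 Lw.
have Lfy := clamp01M_L2 Lw Lwy; have Lfz := clamp01M_L2 Lw Lwz.
have gf := zero_trace_approx_weak_gradient Lf Lfy Lfz As.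
exists (@MkW12 R _ (fun p => (_, _)) Lf Lfy Lfz gf); split=> //; last first.
  exact: (zero_trace_approx_eq0 Lf Lfy As).
have [Cs sf sfy sfz s0] := As.
(* Since [clamp01] has values in [0, 1], the product with the weight is dominated by the difference
   of the two given integrable functions. *)
have damp (f g : plane -> R) : L1 (leb2 R) Omega (fun p => p.2 * f p) ->
    L1 (leb2 R) Omega (fun p => p.2 * g p) ->
    measurable_fun Omega (fun p : plane => clamp01 (u p - v p) * (f p - g p)) ->
    L1 (leb2 R) Omega (fun p => p.2 * (clamp01 (u p - v p) * (f p - g p))).
  move=> fi gi mfg; apply: le_integrable (integrableB mO fi gi) => //.
    apply/measurable_EFinP/measurable_funM => //.
    exact: measurable_funTS measurable_snd.
  move=> p Op; rewrite /= lee_fin -mulrBr !normrM ler_wpM2l// ler_piMl//.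
  by rewrite ger0_norm ?clamp01_ge0 ?clamp01_le1.
split=> /=.
- split; last by exists (fun n => @spos R \o (a n \- b n)).
  move=> s s1; split; first exact: measurable_cst.
  by under eq_fun do rewrite expr0n/=; exact: integrable0.
- by apply: damp => //; case: Lfy.
- by apply: damp => //; case: Lfz.
Qed.

(** Monotonicity of the subdifferential of the Euclidean norm: the expression equals |a| + |b| - s.b
    - t.a, and |s|, |t| <= 1. *)
Lemma flux_monotone (a b s t : R * R) :
  enorm s <= 1 -> enorm t <= 1 -> dot s a = enorm a -> dot t b = enorm b ->
  0 <= (s.1 - t.1) * (a.1 - b.1) + (s.2 - t.2) * (a.2 - b.2).
Proof.
move=> s1 t1 sa tb; have := dot_le_enorm b s1; have := dot_le_enorm a t1.
by rewrite -sa -tb /dot; lra.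
Qed.

End comparison.

Theorem proposition4p2 (R : realType) (lambda : R) (lambda_gt1 : 1 < lambda)
    (u v : W12 R) (qu qv : R * R -> R * R)
    (Xu : spaceX u) (Xv : spaceX v) (Lqu : Lambda qu) (Lqv : Lambda qv)
    (usub : subsolution lambda u qu) (vsuper : supersolution lambda v qv)
    (tu tv : R * R -> R) (utrace : is_trace u tu) (vtrace : is_trace v tv)
    (tu0 : ae_lateral (fun p => tu p = 0))
    (tuv : ae_lateral (fun p => tu p <= tv p)) :
  ae_in (@Omega R) (fun p => u p <= v p).
Proof.
have [phi [Xphi phiE gphiE phi0]] := spos_sub_spaceX Xu Xv.
have mO := @measurable_Omega R.
suff dy0 : sqint (leb2 R) (@Omega R) (fun p => (grad phi p).1) = 0%E.
  apply: ae_inS (phi0 dy0) => p _.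
  by rewrite phiE => /spos_eq0; rewrite subr_le0.
have nphi : nonneg phi by apply: aeW => p _; rewrite /= phiE; exact: spos_ge0.
case: usub => _ _ _ /(_ phi Xphi nphi) leu qug.
case: vsuper => _ _ _ /(_ phi Xphi nphi) lev qvg.
have iu := weak_form_integrable u Xphi Lqu.
have iv := weak_form_integrable v Xphi Lqv.
have iuv := integrableB mO iu iv.
set d := (X in _.-integrable _ X) in iuv.
have d_le0 : (\int[leb2 R]_(p in @Omega R) d p <= 0)%E.
  have fd := integrable_fin_num mO iuv.
  rewrite -(fineK fd) lee_fin.
  have := RintegralB mO iu iv; rewrite /Rintegral => ->.
  (* Both weak forms are compared with the same number, [lambda] times the integral of [phi], which
     cancels. *)
  by rewrite subr_le0; exact: le_trans leu lev.
have [mpy _] := grad_L2y phi.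
have d_ge : ae_in (@Omega R) (fun p => (((grad phi p).1 ^+ 2)%:E <= d p)%E).
  case: Lqu => _ qu1; case: Lqv => _ qv1.
  apply: ae_inS (ae_inI (ae_inI qu1 qv1) (ae_inI qug qvg)).
  move=> p _ [[{}qu1 {}qv1] [{}qug {}qvg]].
  have := flux_monotone qu1 qv1 qug qvg.
  rewrite /d /= lee_fin gphiE /dot /=.
  have := clamp01_ge0 (u p - v p); have := clamp01_le1 (u p - v p).
  move: (clamp01 _) (grad u p) (grad v p) (qu p) (qv p) => c a b s t c1 c0 /= m0.
  (* The integrand minus the squared y-derivative of [phi] is the sum of three nonnegative terms:
     the flux term, the z-part of the gradient term, and what remains of its y-part, with factor
     [c - c ^+ 2]. *)
  have m1 := mulr_ge0 (mulr_ge0 c0 (normr_ge0 p.2)) m0.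
  have m2 := mulr_ge0 c0 (sqr_ge0 (a.2 - b.2)).
  have m3 : 0 <= (c - c ^+ 2) * (a.1 - b.1) ^+ 2.
    by apply: mulr_ge0; [nra|exact: sqr_ge0].
  rewrite -subr_ge0; move: (addr_ge0 (addr_ge0 m1 m2) m3).
  by congr (0 <= _); ring.
have md := measurable_int _ iuv.
apply/eqP; rewrite eq_le sqint_ge0 andbT (le_trans _ d_le0)//.
(* The comparison of integrals below asks for functions nonnegative at every point, whereas [d] is
   so only almost everywhere; its positive part has the same integral. *)
have -> : (\int[leb2 R]_(p in @Omega R) d p =
    \int[leb2 R]_(p in @Omega R) d^\+ p)%E.
  apply: ae_eq_integral => //; first exact: measurable_funepos.
  apply: ae_inS d_ge => p _ h; rewrite funeposE; apply/esym/max_idPl.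
  by rewrite (le_trans _ h)// lee_fin sqr_ge0.
apply: ae_ge0_le_integral => //.
- by move=> p _; rewrite lee_fin sqr_ge0.
- exact: measurable_sqr.
- exact: measurable_funepos.
- by apply: ae_inS d_ge => p _ h; rewrite (le_trans h)// funeposE le_max lexx.
Qed.
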